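(* Let $S$ be a spacelike surface immersed in a 4-dimensional Lorentzian manifold $(\mathcal V,g)$. Then $S$ is umbilical along a normal direction if and only if the normal curvature of $S$ equals the tangent-normal part of the Riemann tensor of $(\mathcal V,g)$, that is, $$R^\perp(X,Y)N=\left(R(X,Y)N\right)^\perp$$ for all vector fields $X,Y$ tangent to $S$ and all vector fields $N$ normal to $S$.
   Context: $(\mathcal V,g)$ is a 4-dimensional, oriented and time-oriented Lorentzian manifold of signature $(-,+,+,+)$ with Levi-Civita connection $\nabla$ and curvature $R(X,Y)Z=\nabla_X\nabla_YZ-\nabla_Y\nabla_XZ-\nabla_{[X,Y]}Z$. $S$ is an immersed 2-dimensional surface, identified locally with its image (considerations are local, so $S$ may be taken embedded and oriented), which is spacelike: the induced metric $\bar g$ is positive definite. For $x\in S$, $T_x\mathcal V=T_xS\oplus T_xS^\perp$, and superscripts $T$ and $\perp$ on vectors denote tangential and normal components. The normal connection is $D_XN=(\nabla_XN)^\perp$, and the normal curvature is $R^\perp(X,Y)N=D_XD_YN-D_YD_XN-D_{[X,Y]}N$, for $X,Y$ tangent and $N$ normal to $S$. The Weingarten operator of a normal field $N$ is $A_N(X)=(\nabla_XN)^T$ for $X$ tangent to $S$; at each point it depends only on $N|_x\in T_xS^\perp$. The mean curvature vector $H$ is the trace with respect to $\bar g$ of the shape tensor $\mathrm{II}(X,Y)=-(\nabla_XY)^\perp$, so $\mathrm{tr}A_N=g(H,N)$. A point $x\in S$ is umbilical along $N\in T_xS^\perp$ if $A_N|_x=\frac12 g(H,N)\,\mathbf 1$.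 $S$ is umbilical along a normal direction if for each $x\in S$ there is a nonzero $N\in T_xS^\perp$ along which $x$ is umbilical. *)

(* Defs.v *)
From HB Require Import structures.
From mathcomp Require Import all_boot all_order all_algebra.
From mathcomp Require Import all_classical all_reals all_analysis.
Set Implicit Arguments.
Unset Strict Implicit.
Unset Printing Implicit Defensive.
Import Order.TTheory GRing.Theory Num.Theory.
Import numFieldNormedType.Exports.
Local Open Scope classical_set_scope.
Local Open Scope ring_scope.

(* Conventions.  Vectors are row vectors and matrices act on the right; in
   particular ['J F u] has the partial derivatives of [F] as its rows, and
   [v *m 'J F u] is the derivative of [F] at [u] along [v]. *)

(* Meaningful for [A] open. *)
Fixpoint Ck_on {R : realType} {n : nat} {W : normedModType R} (k : nat)
    (A : set 'rV[R]_n) (f : 'rV[R]_n -> W) : Prop :=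
  if k is k'.+1 then
    (forall x, A x -> differentiable f x) /\
    (forall v, Ck_on k' A (fun x => 'D_v f x))
  else forall x, A x -> {for x, continuous f}.

Definition smooth_on {R : realType} {n : nat} {W : normedModType R}
    (A : set 'rV[R]_n) (f : 'rV[R]_n -> W) : Prop :=
  forall k, Ck_on k A f.

(* A smooth manifold given by an atlas.  [param i] is the inverse of the chart
   [coord i]; its values outside [coord i @` dom i] are irrelevant.  [chart_at]
   is an arbitrary choice of a chart around each point, and the tangent space
   at [p] is ['rV[R]_n], a vector being represented by its components in the
   chart [chart_at p]. *)
Record manifold (R : realType) (n : nat) := Manifold {
  carrier :> topologicalType;
  manifold_hausdorff : hausdorff_space carrier;
  manifold_second_countable : @second_countable carrier;
  chart : Type;
  dom : chart -> set carrier;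
  coord : chart -> carrier -> 'rV[R]_n;
  param : chart -> 'rV[R]_n -> carrier;
  chart_at : carrier -> chart;
  dom_chart_at : forall p, dom (chart_at p) p;
  dom_open : forall i, open (dom i);
  coord_open : forall i, open (coord i @` dom i);
  coordK : forall i p, dom i p -> param i (coord i p) = p;
  coord_continuous : forall i p, dom i p -> {for p, continuous (coord i)};
  param_continuous : forall i u, (coord i @` dom i) u ->
    {for u, continuous (param i)};
  transition_smooth : forall i j,
    smooth_on (coord i @` (dom i `&` dom j)) (coord j \o param i)
}.

(* An orientation is given by an atlas whose transition maps preserve it. *)
Definition oriented {R : realType} {n : nat} (M : manifold R n) : Prop :=
  forall (i j : chart M) (p : M), dom i p -> dom j p ->
    0 < \det ('J (coord j \o param i) (coord i p)).

(* Components in the chart [j] of the tangent vector [w] at [q]. *)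
Definition components {R : realType} {n : nat} {M : manifold R n}
    (j : chart M) (q : M) (w : 'rV[R]_n) : 'rV[R]_n :=
  w *m 'J (coord j \o param (chart_at q)) (coord (chart_at q) q).

Definition local_map {R : realType} {m n : nat} {M : manifold R m}
    {N : manifold R n} (f : M -> N) (i : chart M) (j : chart N) :
    'rV[R]_m -> 'rV[R]_n :=
  coord j \o f \o param i.

Definition smooth_map {R : realType} {m n : nat} {M : manifold R m}
    {N : manifold R n} (f : M -> N) : Prop :=
  continuous f /\
  forall i j, smooth_on (coord i @` (dom i `&` f @^-1` dom j))
    (local_map f i j).

(* [v *m differential f x] is the image of [v] under the differential. *)
Definition differential {R : realType} {m n : nat} {M : manifold R m}
    {N : manifold R n} (f : M -> N) (x : M) : 'M[R]_(m, n) :=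
  'J (local_map f (chart_at x) (chart_at (f x))) (coord (chart_at x) x).

Definition immersion {R : realType} {m n : nat} {M : manifold R m}
    {N : manifold R n} (f : M -> N) : Prop :=
  smooth_map f /\ forall x, row_free (differential f x).

(* Vector fields along [f]: [W x] is a tangent vector of [N] at [f x].
   For [f := idfun] these are the vector fields of [M]. *)
Definition local_field {R : realType} {m n : nat} {M : manifold R m}
    {N : manifold R n} (f : M -> N) (i : chart M) (j : chart N)
    (W : M -> 'rV[R]_n) : 'rV[R]_m -> 'rV[R]_n :=
  fun u => components j (f (param i u)) (W (param i u)).

Definition smooth_field {R : realType} {m n : nat} {M : manifold R m}
    {N : manifold R n} (f : M -> N) (U : set M) (W : M -> 'rV[R]_n) : Prop :=
  forall i j, smooth_on (coord i @` (U `&` dom i `&` f @^-1` dom j))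
    (local_field f i j W).

Definition inner {R : realType} {n : nat} (A : 'M[R]_n) (v w : 'rV[R]_n) : R :=
  (v *m A *m w^T) 0 0.

Definition minkowski (R : realType) (n : nat) : 'M[R]_n :=
  diag_mx (\row_k (if val k == 0%N then -1 else 1)).

(* Gram matrix, in the coordinates of the chart [i], of the metric whose Gram
   matrix at [p], in the chart [chart_at p], is [g p]. *)
Definition local_metric {R : realType} {n : nat} {M : manifold R n}
    (g : M -> 'M[R]_n) (i : chart M) (u : 'rV[R]_n) : 'M[R]_n :=
  let p := param i u in
  let J := 'J (coord (chart_at p) \o param i) u in
  J *m g p *m J^T.

Record lorentz_metric (R : realType) (n : nat) (M : manifold R n) :=
LorentzMetric {
  gram :> M -> 'M[R]_n;
  gram_smooth : forall i, smooth_on (coord i @` dom i) (local_metric gram i);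
  gram_sym : forall p, (gram p)^T = gram p;
  gram_signature : forall p, exists2 P : 'M[R]_n,
    P \in unitmx & P *m gram p *m P^T = minkowski R n
}.

(* A time orientation is given by a timelike vector field. *)
Definition time_orientation {R : realType} {n : nat} {V : manifold R n}
    (g : lorentz_metric V) (T : V -> 'rV[R]_n) : Prop :=
  smooth_field (idfun : V -> V) setT T /\ forall p, inner (g p) (T p) (T p) < 0.

(* [G] is the Gram matrix of a metric in coordinates of an open set of
   ['rV[R]_n] and [F] is a map from an open set of ['rV[R]_m] to it. *)

(* Christoffel symbols: the vector [christoffel G p v w] is the covariant
   derivative along [v] of the field with constant components [w], as given by
   Koszul's formula for fields with constant components. *)
Definition christoffel {R : realType} {n : nat} (G : 'rV[R]_n -> 'M[R]_n)
    (p v w : 'rV[R]_n) : 'rV[R]_n :=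
  (\row_l let e : 'rV[R]_n := delta_mx 0 l in
    2%:R^-1 * (inner ('D_v G p) w e + inner ('D_w G p) v e
               - inner ('D_e G p) v w))
  *m invmx (G p).

(* Levi-Civita derivative along [F]; for [F := idfun] it is the Levi-Civita
   connection of [G] itself. *)
Definition covd {R : realType} {m n : nat} (G : 'rV[R]_n -> 'M[R]_n)
    (F : 'rV[R]_m -> 'rV[R]_n) (X : 'rV[R]_m -> 'rV[R]_m)
    (W : 'rV[R]_m -> 'rV[R]_n) (u : 'rV[R]_m) : 'rV[R]_n :=
  'D_(X u) W u + christoffel G (F u) ('D_(X u) F u) (W u).

Definition bracket {R : realType} {m : nat} (X Y : 'rV[R]_m -> 'rV[R]_m)
    (u : 'rV[R]_m) : 'rV[R]_m :=
  'D_(X u) Y u - 'D_(Y u) X u.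

Definition local_riemann {R : realType} {n : nat} (G : 'rV[R]_n -> 'M[R]_n)
    (X Y Z : 'rV[R]_n -> 'rV[R]_n) (p : 'rV[R]_n) : 'rV[R]_n :=
  covd G idfun X (covd G idfun Y Z) p - covd G idfun Y (covd G idfun X Z) p
  - covd G idfun (bracket X Y) Z p.

(* [A] is the Gram matrix of the ambient metric at a point and the rows of [J]
   are a basis of the tangent space of the submanifold, so that the induced
   metric is [J *m A *m J^T].  The tangential part of [w] is expressed by its
   components in this basis, the normal part as an ambient vector. *)
Definition tangential {R : realType} {m n : nat} (A : 'M[R]_n)
    (J : 'M[R]_(m, n)) (w : 'rV[R]_n) : 'rV[R]_m :=
  w *m A *m J^T *m invmx (J *m A *m J^T).

Definition normal {R : realType} {m n : nat} (A : 'M[R]_n)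
    (J : 'M[R]_(m, n)) (w : 'rV[R]_n) : 'rV[R]_n :=
  w - tangential A J w *m J.

Definition normal_covd {R : realType} {m n : nat} (G : 'rV[R]_n -> 'M[R]_n)
    (F : 'rV[R]_m -> 'rV[R]_n) (X : 'rV[R]_m -> 'rV[R]_m)
    (N : 'rV[R]_m -> 'rV[R]_n) (u : 'rV[R]_m) : 'rV[R]_n :=
  normal (G (F u)) ('J F u) (covd G F X N u).

Definition local_normal_curvature {R : realType} {m n : nat}
    (G : 'rV[R]_n -> 'M[R]_n) (F : 'rV[R]_m -> 'rV[R]_n)
    (X Y : 'rV[R]_m -> 'rV[R]_m) (N : 'rV[R]_m -> 'rV[R]_n)
    (u : 'rV[R]_m) : 'rV[R]_n :=
  normal_covd G F X (normal_covd G F Y N) u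
  - normal_covd G F Y (normal_covd G F X N) u
  - normal_covd G F (bracket X Y) N u.

Definition local_weingarten {R : realType} {m n : nat}
    (G : 'rV[R]_n -> 'M[R]_n) (F : 'rV[R]_m -> 'rV[R]_n)
    (N : 'rV[R]_m -> 'rV[R]_n) (X : 'rV[R]_m -> 'rV[R]_m)
    (u : 'rV[R]_m) : 'rV[R]_m :=
  tangential (G (F u)) ('J F u) (covd G F X N u).

Definition local_shape_tensor {R : realType} {m n : nat}
    (G : 'rV[R]_n -> 'M[R]_n) (F : 'rV[R]_m -> 'rV[R]_n)
    (X Y : 'rV[R]_m -> 'rV[R]_m) (u : 'rV[R]_m) : 'rV[R]_n :=
  - normal_covd G F X (fun t => Y t *m 'J F t) u.

Definition local_mean_curvature {R : realType} {m n : nat}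
    (G : 'rV[R]_n -> 'M[R]_n) (F : 'rV[R]_m -> 'rV[R]_n)
    (u : 'rV[R]_m) : 'rV[R]_n :=
  \sum_(a < m) \sum_(b < m)
    (invmx ('J F u *m G (F u) *m ('J F u)^T)) a b *:
      local_shape_tensor G F (cst (delta_mx 0 a)) (cst (delta_mx 0 b)) u.

(* The objects below are tensorial, hence may be computed at a point in any
   chart; those given by [chart_at] are used, so that the components obtained
   are the ones representing tangent vectors at that point. *)

Definition spacelike {R : realType} {m n : nat} {S : manifold R m}
    {V : manifold R n} (g : lorentz_metric V) (f : S -> V) : Prop :=
  forall (x : S) (v : 'rV[R]_m), v != 0 ->
    0 < inner (g (f x)) (v *m differential f x) (v *m differential f x).

Definition normal_vector {R : realType} {m n : nat} {S : manifold R m}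
    {V : manifold R n} (g : lorentz_metric V) (f : S -> V) (x : S)
    (w : 'rV[R]_n) : Prop :=
  forall v : 'rV[R]_m, inner (g (f x)) w (v *m differential f x) = 0.

Definition normal_field {R : realType} {m n : nat} {S : manifold R m}
    {V : manifold R n} (g : lorentz_metric V) (f : S -> V) (U : set S)
    (N : S -> 'rV[R]_n) : Prop :=
  smooth_field f U N /\ forall x, U x -> normal_vector g f x (N x).

Definition tangent_field {R : realType} {m : nat} {S : manifold R m}
    (U : set S) (X : S -> 'rV[R]_m) : Prop :=
  smooth_field (idfun : S -> S) U X.

Definition normal_part {R : realType} {m n : nat} {S : manifold R m}
    {V : manifold R n} (g : lorentz_metric V) (f : S -> V) (x : S)
    (w : 'rV[R]_n) : 'rV[R]_n :=
  normal (g (f x)) (differential f x) w.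

(* Being a tensor, the curvature is evaluated on vectors by extending them to
   fields with constant components. *)
Definition riemann {R : realType} {n : nat} {V : manifold R n}
    (g : lorentz_metric V) (p : V) (v w z : 'rV[R]_n) : 'rV[R]_n :=
  local_riemann (local_metric g (chart_at p)) (cst v) (cst w) (cst z)
    (coord (chart_at p) p).

Definition normal_curvature {R : realType} {m n : nat} {S : manifold R m}
    {V : manifold R n} (g : lorentz_metric V) (f : S -> V)
    (X Y : S -> 'rV[R]_m) (N : S -> 'rV[R]_n) (x : S) : 'rV[R]_n :=
  let i := chart_at x in
  let j := chart_at (f x) in
  local_normal_curvature (local_metric g j) (local_map f i j)
    (local_field (idfun : S -> S) i i X) (local_field (idfun : S -> S) i i Y)
    (local_field f i j N) (coord i x).

Definition weingarten {R : realType} {m n : nat} {S : manifold R m}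
    {V : manifold R n} (g : lorentz_metric V) (f : S -> V)
    (N : S -> 'rV[R]_n) (x : S) (v : 'rV[R]_m) : 'rV[R]_m :=
  let i := chart_at x in
  let j := chart_at (f x) in
  local_weingarten (local_metric g j) (local_map f i j)
    (local_field f i j N) (cst v) (coord i x).

Definition mean_curvature {R : realType} {m n : nat} {S : manifold R m}
    {V : manifold R n} (g : lorentz_metric V) (f : S -> V) (x : S) :
    'rV[R]_n :=
  let i := chart_at x in
  let j := chart_at (f x) in
  local_mean_curvature (local_metric g j) (local_map f i j) (coord i x).

(* The Weingarten operator at [x] depends on a normal field only through its
   value [w] at [x], hence the choice of the local extension [N] of [w] is
   immaterial. *)
Definition umbilical_along {R : realType} {n : nat} {S : manifold R 2}
    {V : manifold R n} (g : lorentz_metric V) (f : S -> V) (x : S)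
    (w : 'rV[R]_n) : Prop :=
  exists (U : set S) (N : S -> 'rV[R]_n),
    [/\ open U, U x, normal_field g f U N, N x = w
      & forall v : 'rV[R]_2, weingarten g f N x v =
          (2%:R^-1 * inner (g (f x)) (mean_curvature g f x) w) *: v].

Definition umbilical_along_normal_direction {R : realType} {n : nat}
    {S : manifold R 2} {V : manifold R n} (g : lorentz_metric V)
    (f : S -> V) : Prop :=
  forall x : S, exists w : 'rV[R]_n,
    [/\ w != 0, normal_vector g f x w & umbilical_along g f x w].

(* Main.v *)
From mathcomp Require Import all_boot all_order all_algebra.
From mathcomp Require Import all_classical all_reals all_analysis.
From mathcomp Require Import ring lra.
Require Import Defs.

(** The proof rests on the Ricci equation.  Write the ambient derivative of a
    normal field [N] along a tangent field [Y] as its normal derivative plus the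
    tangent field [A_N Y].  Differentiating once more and antisymmetrizing, the
    normal part of [R(X, Y)N] differs from the normal curvature by
    [II(Y, A_N X) - II(X, A_N Y)], up to sign ([ricci_equation]).  The inner
    product of this difference with a normal vector [M] is the commutator of the
    Weingarten operators [A_M] and [A_N] evaluated on [X] and [Y]
    ([ricci_defect]).  Hence the two curvatures agree if and only if all the
    Weingarten operators at each point commute.

    Both the normal space and the space of traceless self-adjoint operators of a
    tangent plane are two-dimensional, and two traceless self-adjoint operators of
    a Euclidean plane commute if and only if they are proportional.  So all the
    Weingarten operators commute if and only if the linear map sending a normal
    vector [w] to the traceless part of [A_w] has rank at most one, that is, has a
    nonzero kernel; the nonzero vectors of the kernel are the directions along
    which the point is umbilical.  In the text, [A_w] is replaced by the second
    fundamental form [K w] along [w], a symmetric form, and [P] is the first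
    fundamental form: commutation is the vanishing of the determinant of [P],
    [K v] and [K w] in the three-dimensional space of symmetric forms
    ([triple_detP]), and umbilical vectors are those for which [K w] is a multiple
    of [P] ([umbilical_alongP]); [umbilic_direction_triple_det] relates the two.

    The Ricci equation is computed in coordinates.  The Christoffel symbols are
    gathered in a connection matrix, in terms of which the curvature along a map
    and that of the ambient space have the same expression ([curvature_along]).
    The symmetry of the second derivatives ([derive_swap]) is what makes the
    commutators tensorial and the second fundamental form symmetric.

    To pass from the pointwise statement to fields, vectors at a point are
    extended to smooth tangent and normal fields on a neighborhood
    ([tangent_extension], [normal_extension]); the converse passage uses that both
    sides of the identity depend only on the values of the fields at the point. *)

Set Implicit Arguments.
Unset Strict Implicit.
Unset Printing Implicit Defensive.
Import Order.TTheory GRing.Theory Num.Theory.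
Import numFieldNormedType.Exports.
Local Open Scope classical_set_scope.
Local Open Scope ring_scope.

(** * Differential calculus of matrix-valued maps *)

Lemma near_eq_differentiable (R : realType) (V W : normedModType R)
    (f g : V -> W) (x : V) :
  (\near x, f x = g x) -> differentiable f x -> differentiable g x.
Proof.
move=> fg df; have fgx := nbhs_singleton fg.
have gE : g \o shift x = cst (g x) + 'd f x +o_ 0 id.
  apply/eqaddoP => e e0.
  have /eqaddoP/(_ e e0) := diff_locally df.
  move: fg; rewrite (near_shift 0 x) /= => fg.
  apply: filterS2 fg => h; rewrite subr0 => fg.
  by rewrite -[leLHS]/(`|f (h + x) - (f x + 'd f x h)|) fg fgx.
have dgE : 'd g x = 'd f x :> (V -> W).
  by apply: (@diff_unique _ _ _ _ ('d f x)) => //; exact: diff_continuous.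
by apply/diff_locallyP; rewrite dgE; split=> //; exact: diff_continuous.
Qed.

Section MatrixDerivative.
Context {R : realType} {V : normedModType R}.

Lemma differentiable_mxP m n (M : V -> 'M[R]_(m, n)) (x : V) :
  differentiable M x <-> forall i j, differentiable (fun t => M t i j : R) x.
Proof.
split=> [dM i j|dM].
  exact: (differentiable_comp dM (differentiable_coord _ _ _)).
have -> : M = \sum_(i < m) \sum_(j < n) (fun t => M t i j *: delta_mx i j).
  apply/funext => t; rewrite fct_sumE [LHS]matrix_sum_delta.
  by apply: eq_bigr => i _; rewrite fct_sumE.
apply: differentiable_sum => i; apply: differentiable_sum => j.
exact: differentiableZl.
Qed.

Lemma derive_mxE m n (M : V -> 'M[R]_(m, n)) (x v : V) i j :
  differentiable M x -> ('D_v M x) i j = 'D_v (fun t => M t i j : R) x.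
Proof. by move=> dM; rewrite derive_mx ?mxE//; exact: diff_derivable. Qed.

Lemma differentiable_mulmx m n p (M : V -> 'M[R]_(m, n))
    (N : V -> 'M[R]_(n, p)) (x : V) :
  differentiable M x -> differentiable N x ->
  differentiable (fun t => M t *m N t) x.
Proof.
move=> /differentiable_mxP dM /differentiable_mxP dN.
apply/differentiable_mxP => i j.
have -> : (fun t => (M t *m N t) i j) =
    \sum_(k < n) ((fun t => M t i k : R) * (fun t => N t k j)).
  by apply/funext => t; rewrite mxE fct_sumE.
by apply: differentiable_sum => k; exact: differentiableM.
Qed.

Lemma derive_mulmx m n p (M : V -> 'M[R]_(m, n)) (N : V -> 'M[R]_(n, p))
    (x v : V) : differentiable M x -> differentiable N x ->
  'D_v (fun t => M t *m N t) x = 'D_v M x *m N x + M x *m 'D_v N x.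
Proof.
move=> dM dN; have dMN := differentiable_mulmx dM dN.
apply/matrixP => i j; rewrite derive_mxE//.
move: (dM) (dN) => /differentiable_mxP dMc /differentiable_mxP dNc.
have -> : (fun t => (M t *m N t) i j) =
    \sum_(k < n) ((fun t => M t i k : R) * (fun t => N t k j)).
  by apply/funext => t; rewrite mxE fct_sumE.
rewrite derive_sum; last first.
  by move=> k; apply/diff_derivable/differentiableM.
rewrite !mxE -big_split /=; apply: eq_bigr => k _.
rewrite deriveM; [|exact/diff_derivable..].
by rewrite -!derive_mxE// addrC; congr (_ + _); rewrite /GRing.scale /= mulrC.
Qed.

Lemma differentiable_trmx m n (M : V -> 'M[R]_(m, n)) (x : V) :
  differentiable M x -> differentiable (fun t => (M t)^T) x.
Proof.
move=> /differentiable_mxP dM; apply/differentiable_mxP => i j.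
by under eq_fun do rewrite mxE.
Qed.

Lemma derive_trmx m n (M : V -> 'M[R]_(m, n)) (x v : V) :
  differentiable M x -> 'D_v (fun t => (M t)^T) x = ('D_v M x)^T.
Proof.
move=> dM; apply/matrixP => i j.
rewrite derive_mxE; last exact: differentiable_trmx.
rewrite mxE (derive_mxE _ _ _ dM).
by have -> : (fun t => (M t)^T i j) = (fun t => M t j i)
  by apply/funext => t; rewrite mxE.
Qed.

Lemma derive_comp (W U : normedModType R) (f : V -> W) (g : W -> U)
    (x v : V) : differentiable f x -> differentiable g (f x) ->
  'D_v (g \o f) x = 'D_('D_v f x) g (f x).
Proof.
move=> df dg; rewrite !deriveE//; last exact: differentiable_comp.
by rewrite diff_comp.
Qed.

Lemma derive_linear (W : normedModType R) (f : V -> W) (x : V) (a : R)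
    (v w : V) : differentiable f x ->
  'D_(a *: v + w) f x = a *: 'D_v f x + 'D_w f x.
Proof. by move=> df; rewrite !deriveE// linearP. Qed.

Lemma derive_dirB (W : normedModType R) (f : V -> W) (x v w : V) :
  differentiable f x -> 'D_(v - w) f x = 'D_v f x - 'D_w f x.
Proof. by move=> df; rewrite !deriveE// linearB. Qed.

End MatrixDerivative.

Lemma derive_row_sum (R : realType) n (W : normedModType R)
    (f : 'rV[R]_n -> W) (x v : 'rV[R]_n) : differentiable f x ->
  'D_v f x = \sum_(k < n) v 0 k *: 'D_(delta_mx 0 k) f x.
Proof.
move=> df; rewrite {1}[v]row_sum_delta !deriveE// linear_sum.
by apply: eq_bigr => k _; rewrite linearZ deriveE.
Qed.

Lemma jacobian_comp (R : realType) m n p (f : 'rV[R]_m -> 'rV[R]_n)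
    (g : 'rV[R]_n -> 'rV[R]_p) (x : 'rV[R]_m) :
  differentiable f x -> differentiable g (f x) ->
  'J (g \o f) x = 'J f x *m 'J g (f x).
Proof.
move=> df dg; apply/row_matrixP => i.
rewrite !rowE mulmxA -!deriveEjacobian//; last exact: differentiable_comp.
by rewrite derive_comp// deriveEjacobian.
Qed.

Lemma near_eq_jacobian (R : realType) m n (f g : 'rV[R]_m -> 'rV[R]_n)
    (x : 'rV[R]_m) : (\near x, f x = g x) -> differentiable f x ->
  'J f x = 'J g x.
Proof.
move=> fg df; have dg := near_eq_differentiable fg df.
have rowJ (h : 'rV[R]_m -> 'rV[R]_n) i :
    differentiable h x -> row i ('J h x) = 'D_(delta_mx 0 i) h x.
  by move=> dh; rewrite rowE deriveEjacobian.
apply/row_matrixP => i; apply: (etrans (rowJ _ _ df)).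
apply: etrans (esym (rowJ _ _ dg)); exact: near_eq_derive.
Qed.

Lemma jacobian_id (R : realType) n (x : 'rV[R]_n) : 'J id x = 1%:M.
Proof.
apply/row_matrixP => i; rewrite !rowE -deriveEjacobian//.
by rewrite derive_id mulmx1.
Qed.

(** * Closure properties of smoothness *)

Section Smoothness.
Context {R : realType} {n : nat}.
Implicit Types (A B : set 'rV[R]_n) (W : normedModType R).

Lemma open_near W A (f g : 'rV[R]_n -> W) x :
  open A -> (forall t, A t -> f t = g t) -> A x -> \near x, f x = g x.
Proof.
move=> oA fg Ax; have : nbhs x A by exact: open_nbhs_nbhs.
by apply: filterS => t /fg.
Qed.

Lemma Ck_on_eq W k A (f g : 'rV[R]_n -> W) :
  open A -> (forall x, A x -> f x = g x) -> Ck_on k A f -> Ck_on k A g.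
Proof.
move=> oA; elim: k => [|k IHk] /= in f g * => fg.
  move=> cf x Ax; have fgn := open_near oA fg Ax.
  have cgx : f t @[t --> x] --> g x by rewrite -fg//; exact: cf.
  exact: cvg_trans (near_eq_cvg fgn) cgx.
move=> [df Df]; split=> [x Ax|v].
  by apply: near_eq_differentiable (df x Ax); exact: open_near fg Ax.
apply: IHk (Df v) => x Ax; apply: near_eq_derive; exact: open_near fg Ax.
Qed.

Lemma Ck_onW W k A (f : 'rV[R]_n -> W) : Ck_on k.+1 A f -> Ck_on k A f.
Proof.
elim: k => [|k IHk] /= in f *.
  by move=> [df _] x /df; exact: differentiable_continuous.
by move=> [df Df]; split=> // v; apply: IHk; exact: Df.
Qed.

Lemma Ck_on_sub W k A B (f : 'rV[R]_n -> W) :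
  A `<=` B -> Ck_on k B f -> Ck_on k A f.
Proof.
move=> AB; elim: k => [|k IHk] /= in f *; first by move=> cf x /AB/cf.
by move=> [df Df]; split=> [x /AB/df//|v]; apply: IHk.
Qed.

Lemma Ck_on_cst W k A (c : W) : Ck_on k A (fun=> c : W).
Proof.
elim: k c => [|k IHk] c /=; first by move=> x _; exact: cst_continuous.
split=> [x _|v]; first exact: differentiable_cst.
by under eq_fun do rewrite derive_cst; exact: IHk.
Qed.

Lemma Ck_onD W k A (f g : 'rV[R]_n -> W) : open A ->
  Ck_on k A f -> Ck_on k A g -> Ck_on k A (fun x => f x + g x).
Proof.
move=> oA; elim: k => [|k IHk] /= in f g *.
  by move=> cf cg x Ax; apply: continuousD; [exact: cf|exact: cg].
move=> [df Df] [dg Dg]; split=> [x Ax|v].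
  by apply: differentiableD; [exact: df|exact: dg].
apply: Ck_on_eq (IHk _ _ (Df v) (Dg v)) => // x Ax.
by rewrite deriveD//; apply: diff_derivable; [exact: df|exact: dg].
Qed.

Lemma Ck_onM k A (f g : 'rV[R]_n -> R) : open A ->
  Ck_on k A f -> Ck_on k A g -> Ck_on k A (fun x => f x * g x).
Proof.
move=> oA; elim: k => [|k IHk] /= in f g *.
  by move=> cf cg x Ax; apply: continuousM; [exact: cf|exact: cg].
move=> /[dup] /(Ck_onW (k := k)) Cf [df Df] /[dup] /(Ck_onW (k := k)) Cg [dg Dg].
split=> [x Ax|v]; first by apply: differentiableM; [exact: df|exact: dg].
apply: Ck_on_eq (Ck_onD oA (IHk _ _ Cf (Dg v)) (IHk _ _ Cg (Df v))) => // x Ax.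
by rewrite deriveM//; apply: diff_derivable; [exact: df|exact: dg].
Qed.

Lemma Ck_onV k A (f : 'rV[R]_n -> R) : open A -> (forall x, A x -> f x != 0) ->
  Ck_on k A f -> Ck_on k A (fun x => (f x)^-1).
Proof.
move=> oA f0; elim: k => [|k IHk] /=.
  by move=> cf x Ax; apply: continuousV; [exact: f0|exact: cf].
move=> /[dup] /(Ck_onW (k := k)) /IHk CV [df Df].
split=> [x Ax|v]; first by apply: differentiableV; [exact: df|exact: f0].
have C := Ck_onM oA (Ck_on_cst k A (- 1 : R)) (Ck_onM oA (Ck_onM oA CV CV) (Df v)).
apply: Ck_on_eq C => // x Ax.
rewrite deriveV; [|exact: f0|by apply: diff_derivable; exact: df].
by rewrite /GRing.scale /= mulN1r mulNr expr2 invfM.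
Qed.

(** Reduces smoothness of matrix-valued maps to that of scalar functions, for
    which products and inverses are available. *)
Lemma Ck_on_mxP p q k A (M : 'rV[R]_n -> 'M[R]_(p, q)) : open A ->
  Ck_on k A M <-> forall i j, Ck_on k A (fun x => M x i j : R).
Proof.
move=> oA; elim: k => [|k IHk] /= in M *.
  split=> [cM i j x Ax|cM x Ax].
    have cij := differentiable_continuous (differentiable_coord (M x) i j).
    exact: (continuous_comp (cM x Ax) cij).
  move=> P [Q MQ QP].
  have : \forall t \near x, forall i j, Q i j (M t i j).
    have MQt i j : \forall t \near x, Q i j (M t i j) := cM i j x Ax _ (MQ i j).
    have MQi i : \forall t \near x, forall j, Q i j (M t i j).
      exact: (@filter_forall _ _ (fun j t => Q i j (M t i j)) _ _ (MQt i)).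
    exact: (@filter_forall _ _ (fun i t => forall j, Q i j (M t i j)) _ _ MQi).
  by apply: filterS => t; exact: QP.
split=> [[dM DM] i j|CM].
  split=> [x /dM /differentiable_mxP//|v].
  by apply: Ck_on_eq ((IHk _).1 (DM v) i j) => // x /dM dMx; exact: derive_mxE.
have dM x : A x -> differentiable M x.
  by move=> Ax; apply/differentiable_mxP => i j; exact: (CM i j).1.
split=> // v; apply/IHk => i j.
apply: Ck_on_eq ((CM i j).2 v) => // x /dM dMx.
by apply/esym; exact: derive_mxE.
Qed.

Lemma Ck_on_sum (I : Type) (s : seq I) (P : pred I) k A
    (F : I -> 'rV[R]_n -> R) : open A ->
  (forall i, Ck_on k A (F i)) -> Ck_on k A (fun x => \sum_(i <- s | P i) F i x).
Proof.
move=> oA CF; elim: s => [|i s IHs].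
  by under eq_fun do rewrite big_nil; exact: Ck_on_cst.
under eq_fun do rewrite big_cons.
by case: (P i) => //; exact: Ck_onD.
Qed.

Lemma Ck_on_prod (I : Type) (s : seq I) (P : pred I) k A
    (F : I -> 'rV[R]_n -> R) : open A ->
  (forall i, Ck_on k A (F i)) -> Ck_on k A (fun x => \prod_(i <- s | P i) F i x).
Proof.
move=> oA CF; elim: s => [|i s IHs].
  by under eq_fun do rewrite big_nil; exact: Ck_on_cst.
under eq_fun do rewrite big_cons.
by case: (P i) => //; exact: Ck_onM.
Qed.

End Smoothness.

(** By the chain rule the derivatives of [g \o f] are sums of products of the
    derivatives of [f] with the compositions with [f] of the partial derivatives
    of [g], so that the induction on [k] applies to the latter. *)
Lemma Ck_on_comp (R : realType) n p k (A : set 'rV[R]_n) (B : set 'rV[R]_p)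
    (f : 'rV[R]_n -> 'rV[R]_p) (g : 'rV[R]_p -> R) :
  open A -> (forall x, A x -> B (f x)) ->
  Ck_on k A f -> Ck_on k B g -> Ck_on k A (fun x => g (f x)).
Proof.
move=> oA fAB; elim: k => [|k IHk] /= in f g fAB *.
  by move=> cf cg x Ax; exact: (continuous_comp (cf x Ax) (cg _ (fAB _ Ax))).
move=> /[dup] /(Ck_onW (k := k)) Cf [df Df] [dg Dg].
split=> [x Ax|v].
  by apply: (differentiable_comp (df _ Ax)); exact/dg/fAB.
have C : Ck_on k A (fun x => \sum_(j < p)
    ('D_v f x) 0 j * 'D_(delta_mx 0 j) g (f x)).
  apply: Ck_on_sum => // j; apply: Ck_onM => //.
    exact: (Ck_on_mxP _ _ oA).1 (Df v) 0 j.
  exact: IHk (Dg _).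
apply: Ck_on_eq C => // x Ax.
rewrite [RHS](derive_comp v (df _ Ax) (dg _ (fAB _ Ax))).
by rewrite [RHS]derive_row_sum//; exact/dg/fAB.
Qed.

Section SmoothOn.
Context {R : realType} {n : nat} {A : set 'rV[R]_n}.
Hypothesis oA : open A.

Lemma smooth_differentiable (W : normedModType R) (f : 'rV[R]_n -> W) x :
  smooth_on A f -> A x -> differentiable f x.
Proof. by move=> /(_ 1)[df _] /df. Qed.

Lemma smooth_continuous (W : normedModType R) (f : 'rV[R]_n -> W) x :
  smooth_on A f -> A x -> {for x, continuous f}.
Proof. by move=> /(_ 0) /= cf /cf. Qed.

Lemma smooth_eq (W : normedModType R) (f g : 'rV[R]_n -> W) :
  (forall x, A x -> f x = g x) -> smooth_on A f -> smooth_on A g.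
Proof. by move=> fg sf k; exact: Ck_on_eq (sf k). Qed.

Lemma smooth_sub (W : normedModType R) (B : set 'rV[R]_n) (f : 'rV[R]_n -> W) :
  B `<=` A -> smooth_on A f -> smooth_on B f.
Proof. by move=> BA sf k; exact: Ck_on_sub (sf k). Qed.

Lemma smooth_cst (W : normedModType R) (c : W) : smooth_on A (cst c).
Proof. by move=> k; exact: Ck_on_cst. Qed.

Lemma smooth_derive (W : normedModType R) (f : 'rV[R]_n -> W) v :
  smooth_on A f -> smooth_on A (fun x => 'D_v f x).
Proof. by move=> sf k; exact: (sf k.+1).2. Qed.

Lemma smoothD (W : normedModType R) (f g : 'rV[R]_n -> W) :
  smooth_on A f -> smooth_on A g -> smooth_on A (fun x => f x + g x).
Proof. by move=> sf sg k; exact: Ck_onD. Qed.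

Lemma smooth_sum (I : Type) (s : seq I) (P : pred I) (F : I -> 'rV[R]_n -> R) :
  (forall i, smooth_on A (F i)) ->
  smooth_on A (fun x => \sum_(i <- s | P i) F i x).
Proof. by move=> sF k; apply: Ck_on_sum => // i; exact: sF. Qed.

Lemma smooth_prod (I : Type) (s : seq I) (P : pred I) (F : I -> 'rV[R]_n -> R) :
  (forall i, smooth_on A (F i)) ->
  smooth_on A (fun x => \prod_(i <- s | P i) F i x).
Proof. by move=> sF k; apply: Ck_on_prod => // i; exact: sF. Qed.

Lemma smoothM (f g : 'rV[R]_n -> R) :
  smooth_on A f -> smooth_on A g -> smooth_on A (fun x => f x * g x).
Proof. by move=> sf sg k; exact: Ck_onM. Qed.

Lemma smoothV (f : 'rV[R]_n -> R) : (forall x, A x -> f x != 0) ->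
  smooth_on A f -> smooth_on A (fun x => (f x)^-1).
Proof. by move=> f0 sf k; exact: Ck_onV. Qed.

Lemma smooth_mxP p q (M : 'rV[R]_n -> 'M[R]_(p, q)) :
  smooth_on A M <-> forall i j, smooth_on A (fun x => M x i j : R).
Proof.
split=> [sM i j k|sM k]; first exact: (Ck_on_mxP _ _ oA).1 (sM k) i j.
by apply/Ck_on_mxP => // i j; exact: sM.
Qed.

Lemma smooth_trmx p q (M : 'rV[R]_n -> 'M[R]_(p, q)) :
  smooth_on A M -> smooth_on A (fun x => (M x)^T).
Proof.
move=> /smooth_mxP sM; apply/smooth_mxP => i j.
by under eq_fun do rewrite mxE; exact: sM.
Qed.

Lemma smooth_mulmx p q r (M : 'rV[R]_n -> 'M[R]_(p, q))
    (N : 'rV[R]_n -> 'M[R]_(q, r)) :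
  smooth_on A M -> smooth_on A N -> smooth_on A (fun x => M x *m N x).
Proof.
move=> /smooth_mxP sM /smooth_mxP sN; apply/smooth_mxP => i j.
under eq_fun do rewrite mxE.
by apply: smooth_sum => k; exact: smoothM.
Qed.

Lemma smoothN p q (M : 'rV[R]_n -> 'M[R]_(p, q)) :
  smooth_on A M -> smooth_on A (fun x => - M x).
Proof.
move=> sM; apply: (smooth_eq (f := fun x => - 1%:M *m M x)).
  by move=> x _; rewrite mulNmx mul1mx.
by apply: smooth_mulmx => //; exact: smooth_cst.
Qed.

Lemma smooth_det p (M : 'rV[R]_n -> 'M[R]_p) :
  smooth_on A M -> smooth_on A (fun x => \det (M x) : R).
Proof.
move=> /smooth_mxP sM; apply: smooth_sum => s; apply: smoothM.
  exact: smooth_cst.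
exact: smooth_prod.
Qed.

(** Cramer's rule makes the entries of the inverse rational functions of the
    entries of the matrix. *)
Lemma smooth_invmx p (M : 'rV[R]_n -> 'M[R]_p) :
  (forall x, A x -> M x \in unitmx) ->
  smooth_on A M -> smooth_on A (fun x => invmx (M x)).
Proof.
move=> uM sM; apply/smooth_mxP => i j.
have E x : A x ->
    (\det (M x))^-1 * ((-1) ^+ (j + i) * \det (row' j (col' i (M x)))) =
    invmx (M x) i j.
  by move=> /uM uMx; rewrite /invmx uMx !mxE.
apply: smooth_eq E _; apply: smoothM.
  apply: smoothV; last exact: smooth_det.
  by move=> x /uM; rewrite unitmxE unitfE.
apply: smoothM; first exact: smooth_cst.
apply: smooth_det; apply/smooth_mxP => k l.
by under eq_fun do rewrite !mxE; exact: (smooth_mxP _).1 sM _ _.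
Qed.

Lemma smooth_comp p q r (B : set 'rV[R]_p) (f : 'rV[R]_n -> 'rV[R]_p)
    (g : 'rV[R]_p -> 'M[R]_(q, r)) :
  open B -> (forall x, A x -> B (f x)) ->
  smooth_on A f -> smooth_on B g -> smooth_on A (fun x => g (f x)).
Proof.
move=> oB fAB sf sg; apply/smooth_mxP => i j k.
exact: Ck_on_comp oA fAB (sf k) ((Ck_on_mxP _ _ oB).1 (sg k) i j).
Qed.

Lemma smooth_jacobian p (f : 'rV[R]_n -> 'rV[R]_p) :
  smooth_on A f -> smooth_on A (fun x => 'J f x).
Proof.
move=> sf; apply/smooth_mxP => i j.
apply: smooth_eq ((smooth_mxP _).1 (smooth_derive (delta_mx 0 i) sf) 0 j).
move=> x Ax; rewrite deriveEjacobian; last exact: smooth_differentiable Ax.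
by rewrite -rowE mxE.
Qed.

Lemma smooth_derive_along p (X : 'rV[R]_n -> 'rV[R]_n) (f : 'rV[R]_n -> 'rV[R]_p) :
  smooth_on A X -> smooth_on A f -> smooth_on A (fun x => 'D_(X x) f x).
Proof.
move=> sX sf; apply: smooth_eq (smooth_mulmx sX (smooth_jacobian sf)) => x Ax.
by rewrite deriveEjacobian//; exact: smooth_differentiable Ax.
Qed.

End SmoothOn.

Lemma smooth_id (R : realType) n (A : set 'rV[R]_n) :
  smooth_on A (idfun : 'rV[R]_n -> _).
Proof.
have did x : differentiable (idfun : 'rV[R]_n -> _) x by exact: ex_diff.
case=> [|k] /=; first by move=> x _; exact: differentiable_continuous.
split=> [x _|v]; first exact: did.
have -> : 'D_v (idfun : 'rV[R]_n -> _) = cst v.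
  by apply/funext => x; rewrite (derive_id x v).
exact: Ck_on_cst.
Qed.

(** * Symmetry of second derivatives *)

Section Schwarz.
Context {R : realType} {n : nat}.
Implicit Types (A : set 'rV[R]_n) (x y u v : 'rV[R]_n).

Lemma mean_value_line (f : 'rV[R]_n -> R) y v (h : R) : 0 <= h ->
  (forall t, 0 <= t <= h -> differentiable f (y + t *: v)) ->
  exists2 c, 0 <= c <= h & f (y + h *: v) - f y = 'D_v f (y + c *: v) * h.
Proof.
move=> h0 df; pose l (t : R) := y + t *: v.
have dl0 t : differentiable ( *:%R^~ v : R -> _) t.
  exact: (ex_diff (is_diff_def := is_diff_scalel t v)).
have dl t : differentiable l t.
  exact: differentiableD (differentiable_cst y t) (dl0 t).
have Dl t : 'D_1 l t = v.
  rewrite /l (deriveD (diff_derivable (differentiable_cst y t)) (diff_derivable (dl0 t))).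
  rewrite derive_cst add0r deriveE//.
  by rewrite (diff_val (is_diff_def := is_diff_scalel t v)) scale1r.
have dfl t : 0 <= t <= h -> is_derive t 1 (f \o l) ('D_v f (l t)).
  move=> th; have dft := df t th.
  split; first by apply/diff_derivable/differentiable_comp.
  by rewrite (derive_comp (1 : R) (dl t) dft) Dl.
have cfl : {within `[0, h], continuous (f \o l)}.
  apply: derivable_within_continuous => t.
  by rewrite in_itv => /= /dfl[].
have fl' t : t \in `]0, h[ -> is_derive t 1 (f \o l) ('D_v f (l t)).
  by rewrite in_itv /= => /andP[t0 th]; apply: dfl; rewrite !ltW.
have [c] := MVT_segment h0 fl' cfl.
by rewrite in_itv /= /l scale0r addr0 subr0 => ch E; exists c.
Qed.

(** The mean value theorem is applied along [u] to the increment of [f] in the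
    direction [h *: v], then along [v] to the derivative of [f] along [u]. *)
Lemma second_difference A (f : 'rV[R]_n -> R) x u v (h : R) :
  0 < h -> smooth_on A f ->
  (forall s t, 0 <= s <= h -> 0 <= t <= h -> A (x + s *: u + t *: v)) ->
  exists s t, [/\ 0 <= s <= h, 0 <= t <= h &
    f (x + h *: u + h *: v) - f (x + h *: u) - f (x + h *: v) + f x =
    'D_v (fun y => 'D_u f y) (x + s *: u + t *: v) * h * h].
Proof.
move=> h0 sf inA; have h0' := ltW h0.
have hh : 0 <= h <= h by rewrite h0' lexx.
have zh : 0 <= (0 : R) <= h by rewrite h0' lexx.
have df t : A t -> differentiable f t by exact: smooth_differentiable.
pose g y := f (y + h *: v) - f y.
have dshift y : differentiable (fun y : 'rV[R]_n => y + h *: v) y by [].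
have dg s : 0 <= s <= h -> differentiable g (x + s *: u).
  move=> sh; apply: differentiableB; last first.
    by apply: df; have := inA s 0 sh zh; rewrite scale0r addr0.
  by apply: (differentiable_comp (dshift _)); apply/df/inA.
have [s sh Es] := mean_value_line h0' dg.
have Dg : 'D_u g (x + s *: u) =
    'D_u f (x + s *: u + h *: v) - 'D_u f (x + s *: u).
  have dfs := df _ (inA s h sh hh).
  rewrite deriveB; last 2 first.
  - by apply/diff_derivable; apply: (differentiable_comp (dshift _)).
  - by apply/diff_derivable/df; have := inA s 0 sh zh; rewrite scale0r addr0.
  have Dshift : 'D_u (fun y : 'rV[R]_n => y + h *: v) (x + s *: u) = u.
    by rewrite deriveD// derive_id derive_cst addr0.
  by rewrite (derive_comp u (dshift (x + s *: u)) dfs) Dshift.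
have dDf t : 0 <= t <= h ->
    differentiable (fun y => 'D_u f y) (x + s *: u + t *: v).
  by move=> th; apply: smooth_differentiable (smooth_derive u sf) _; exact: inA.
have [t th Et] := mean_value_line h0' dDf.
exists s, t; split=> //.
by rewrite -Et -Dg -Es /g; ring.
Qed.

(** Schwarz's theorem.  The second difference of [f] over a small parallelogram
    is symmetric in its two sides, and [second_difference] computes it from a
    value near [x] of either iterated derivative; both are continuous. *)
Lemma derive_swap A (f : 'rV[R]_n -> R) x u v : open A -> smooth_on A f -> A x ->
  'D_u (fun y => 'D_v f y) x = 'D_v (fun y => 'D_u f y) x.
Proof.
move=> oA sf Ax.
set fuv := fun y => 'D_u (fun y => 'D_v f y) y.
set fvu := fun y => 'D_v (fun y => 'D_u f y) y.
rewrite -[LHS]/(fuv x) -[RHS]/(fvu x).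
have cuv : {for x, continuous fuv}.
  by apply: smooth_continuous Ax; apply: smooth_derive; exact: smooth_derive.
have cvu : {for x, continuous fvu}.
  by apply: smooth_continuous Ax; apply: smooth_derive; exact: smooth_derive.
have Evu h (h0 : 0 < h) inA :
    exists s t, [/\ 0 <= s <= h, 0 <= t <= h &
      f (x + h *: u + h *: v) - f (x + h *: u) - f (x + h *: v) + f x =
      fvu (x + s *: u + t *: v) * h * h] :=
  @second_difference A f x u v h h0 sf inA.
have Euv h (h0 : 0 < h) inA :
    exists s t, [/\ 0 <= s <= h, 0 <= t <= h &
      f (x + h *: v + h *: u) - f (x + h *: v) - f (x + h *: u) + f x =
      fuv (x + s *: v + t *: u) * h * h] :=
  @second_difference A f x v u h h0 sf inA.
clearbody fuv fvu.
apply/eqP; rewrite -subr_eq0 -normr_eq0 eq_le normr_ge0 andbT.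
apply/ler_addgt0Pl => e e0.
have e20 : 0 < e / 2 by rewrite divr_gt0.
have near_xA : \forall y \near x,
    [/\ A y, `|fuv x - fuv y| < e / 2 & `|fvu x - fvu y| < e / 2].
  have /cvgrPdist_lt/(_ _ e20) := cvu.
  have /cvgrPdist_lt/(_ _ e20) := cuv.
  have : nbhs x A by exact: open_nbhs_nbhs.
  by apply: filterS3 => y.
have [d /= d0 dP] := (nbhs_ballP _ _).1 near_xA.
(* The parallelogram of sides [h *: u] and [h *: v] lies in [ball x d]. *)
pose h := d / (`|u| + `|v| + 1).
have uv0 : 0 < `|u| + `|v| + 1 by rewrite ltr_wpDl// addr_ge0.
have h0 : 0 < h by rewrite divr_gt0.
have hd s t : 0 <= s <= h -> 0 <= t <= h -> ball x d (x + s *: u + t *: v).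
  move=> /andP[s0 sh] /andP[t0 th]; rewrite -ball_normE /=.
  rewrite -addrA opprD addrA subrr add0r normrN.
  apply: le_lt_trans (ler_normD _ _) _; rewrite !normrZ !ger0_norm//.
  have : s * `|u| + t * `|v| <= h * (`|u| + `|v|).
    by rewrite mulrDr lerD// ler_wpM2r.
  move=> /le_lt_trans; apply; rewrite /h -[ltRHS](divfK (lt0r_neq0 uv0)).
  by rewrite ltr_pM2l ?ltrDl// divr_gt0.
have inA s t (sh : 0 <= s <= h) (th : 0 <= t <= h) : A (x + s *: u + t *: v).
  by have [] := dP _ (hd s t sh th).
have inA' s t (sh : 0 <= s <= h) (th : 0 <= t <= h) : A (x + s *: v + t *: u).
  by rewrite addrAC; exact: inA.
have [s [t [sh th E]]] := Evu h h0 inA.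
have [s' [t' [sh' th' E']]] := Euv h h0 inA'.
rewrite [x + s' *: v + _]addrAC in E'.
have EE : fvu (x + s *: u + t *: v) = fuv (x + t' *: u + s' *: v).
  apply: (mulIf (lt0r_neq0 h0)); apply: (mulIf (lt0r_neq0 h0)).
  by rewrite -E -E' [x + h *: v + _]addrAC; ring.
have [_ _ P1] := dP _ (hd s t sh th); have [_ P2 _] := dP _ (hd t' s' th' sh').
rewrite addr0 [e]splitr ltW//.
apply: le_lt_trans (ltrD P2 P1); rewrite EE [X in _ <= _ + X]distrC.
exact: ler_distD.
Qed.

Lemma derive_swap_mx A p q (F : 'rV[R]_n -> 'M[R]_(p, q)) x u v :
  open A -> smooth_on A F -> A x ->
  'D_u (fun y => 'D_v F y) x = 'D_v (fun y => 'D_u F y) x.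
Proof.
move=> oA sF Ax; apply/matrixP => i j.
have sFij : smooth_on A (fun y => F y i j : R) by exact: (smooth_mxP oA _).1.
have Dij w w' : ('D_w (fun y => 'D_w' F y) x) i j =
    'D_w (fun y => 'D_w' (fun y => F y i j : R) y) x.
  rewrite derive_mxE.
    have E t : A t -> ('D_w' F t) i j = 'D_w' (fun y => F y i j : R) t.
      by move=> At; apply: derive_mxE; exact: smooth_differentiable At.
    exact: near_eq_derive (open_near oA E Ax).
  by apply: smooth_differentiable Ax; exact: smooth_derive.
apply: etrans (Dij _ _) _; apply: etrans _ (esym (Dij _ _)).
exact: derive_swap oA sFij Ax.
Qed.

Lemma derive_jacobian_swap A p (F : 'rV[R]_n -> 'rV[R]_p) x u v :
  open A -> smooth_on A F -> A x ->
  v *m 'D_u (fun t => 'J F t) x = u *m 'D_v (fun t => 'J F t) x.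
Proof.
move=> oA sF Ax.
have DJ w w' : w' *m 'D_w (fun t => 'J F t) x = 'D_w (fun t => 'D_w' F t) x.
  have E t : A t -> 'D_w' F t = w' *m 'J F t.
    by move=> At; apply: deriveEjacobian; exact: smooth_differentiable At.
  rewrite (near_eq_derive _ (open_near oA E Ax)) derive_mulmx.
  - by rewrite derive_cst mul0mx add0r.
  - exact: differentiable_cst.
  - by apply: smooth_differentiable Ax; exact: smooth_jacobian.
apply: etrans (DJ _ _) _; apply: etrans _ (esym (DJ _ _)).
exact: derive_swap_mx oA sF Ax.
Qed.

End Schwarz.

(** The second derivatives of [F] cancel by Schwarz's theorem; only those of the
    coefficients of [X] and [Y] remain. *)
Lemma derive_bracket (R : realType) m n (A : set 'rV[R]_m)
    (X Y : 'rV[R]_m -> 'rV[R]_m) (F : 'rV[R]_m -> 'rV[R]_n) x :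
  open A -> smooth_on A X -> smooth_on A Y -> smooth_on A F -> A x ->
  'D_(X x) (fun t => 'D_(Y t) F t) x - 'D_(Y x) (fun t => 'D_(X t) F t) x =
  'D_(bracket X Y x) F x.
Proof.
move=> oA sX sY sF Ax.
have dF t : A t -> differentiable F t by exact: smooth_differentiable.
have dJ : differentiable (fun t => 'J F t) x.
  by apply: smooth_differentiable Ax; exact: smooth_jacobian.
have second (Z : 'rV[R]_m -> 'rV[R]_m) v : smooth_on A Z ->
    'D_v (fun t => 'D_(Z t) F t) x =
    'D_('D_v Z x) F x + Z x *m 'D_v (fun t => 'J F t) x.
  move=> sZ.
  have E t : A t -> 'D_(Z t) F t = Z t *m 'J F t.
    by move=> At; rewrite deriveEjacobian//; exact: dF.
  rewrite (near_eq_derive _ (open_near oA E Ax)) derive_mulmx//.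
    by rewrite (deriveEjacobian _ (dF x Ax)).
  exact: smooth_differentiable Ax.
have cancel (a b p q : 'rV[R]_n) : p = q -> a + p - (b + q) = a - b.
  by move=> ->; rewrite opprD addrACA subrr addr0.
rewrite (second Y _ sY) (second X _ sX).
rewrite (cancel _ _ _ _ (derive_jacobian_swap (X x) (Y x) oA sF Ax)).
exact: esym (derive_dirB _ _ (dF x Ax)).
Qed.

(** * The connection and its curvature in matrix form *)

Section Inner.
Context {R : realType} {n : nat}.
Implicit Types (A : 'M[R]_n) (u v w : 'rV[R]_n).

Lemma inner_mulmx p A v (B : 'M[R]_(p, n)) (z : 'rV[R]_p) :
  inner A v (z *m B) = (v *m A *m B^T *m z^T) 0 0.
Proof. by rewrite /inner trmx_mul !mulmxA. Qed.

Lemma inner_sym A v w : A^T = A -> inner A v w = inner A w v.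
Proof.
move=> As; rewrite /inner -[LHS]/((_ *m _) 0 0) -[in LHS](trmxK (v *m A *m w^T)).
by rewrite mxE !trmx_mul trmxK As mulmxA.
Qed.

Lemma innerDl A u v w : inner A (u + v) w = inner A u w + inner A v w.
Proof. by rewrite /inner !mulmxDl mxE. Qed.

Lemma innerZl A a v w : inner A (a *: v) w = a * inner A v w.
Proof. by rewrite /inner -!scalemxAl mxE. Qed.

Lemma innerNl A v w : inner A (- v) w = - inner A v w.
Proof. by rewrite /inner !mulNmx mxE. Qed.

Lemma innerBl A u v w : inner A (u - v) w = inner A u w - inner A v w.
Proof. by rewrite innerDl innerNl. Qed.

Lemma innerDr A u v w : inner A u (v + w) = inner A u v + inner A u w.
Proof. by rewrite /inner linearD mulmxDr mxE. Qed.

Lemma inner_delta A v l : inner A v (delta_mx 0 l) = (v *m A) 0 l.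
Proof. by rewrite /inner trmx_delta -colE mxE. Qed.

End Inner.

Section ConnectionMatrix.
Context {R : realType} {n : nat}.
Implicit Types (G : 'rV[R]_n -> 'M[R]_n) (p v w : 'rV[R]_n).

(** Koszul's formula for [christoffel G p v w] is linear in [w]; the matrix of
    this linear map is [connection_mx G p v].  Its last two terms involve the
    derivative of the Gram matrix along [w] or along a basis vector, and are
    given by [koszul_mx G p v] and its transpose. *)
Definition koszul_mx G p v : 'M[R]_n :=
  \matrix_(k, l) (v *m 'D_(delta_mx 0 k) G p) 0 l.

Definition connection_mx G p v : 'M[R]_n :=
  (2%:R^-1 *: ('D_v G p + koszul_mx G p v - (koszul_mx G p v)^T)) *m invmx (G p).

Lemma christoffelE G p v w : differentiable G p ->
  christoffel G p v w = w *m connection_mx G p v.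
Proof.
move=> dG; rewrite /christoffel /connection_mx mulmxA; congr (_ *m _).
apply/rowP => l; rewrite [LHS]mxE -scalemxAr [RHS]mxE.
have -> (a b c : 'M[R]_n) :
    (w *m (a + b - c)) 0 l = (w *m a) 0 l + (w *m b) 0 l - (w *m c) 0 l.
  by rewrite mulmxBr mulmxDr !mxE.
have sum3 (x y z x' y' z' : R) : x = x' -> y = y' -> z = z' ->
  2%:R^-1 * (x + y - z) = 2%:R^-1 * (x' + y' - z') by move=> -> -> ->.
apply: sum3; first exact: inner_delta.
- rewrite inner_delta derive_row_sum// mulmx_sumr summxE [RHS]mxE.
  by apply: eq_bigr => k _; rewrite -scalemxAr [LHS]mxE [in RHS]mxE.
- rewrite /inner [LHS]mxE [RHS]mxE.
  by apply: eq_bigr => k _; rewrite mulrC [in LHS]mxE [in RHS]mxE [in RHS]mxE.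
Qed.

Lemma connection_mx_linear G p a v w : differentiable G p ->
  connection_mx G p (a *: v + w) = a *: connection_mx G p v + connection_mx G p w.
Proof.
move=> dG; rewrite /connection_mx.
have -> : koszul_mx G p (a *: v + w) = a *: koszul_mx G p v + koszul_mx G p w.
  by apply/matrixP => k l; rewrite [LHS]mxE mulmxDl -scalemxAl !mxE.
have alg (d d' k k' : 'M[R]_n) : a *: d + d' + (a *: k + k') - (a *: k + k')^T =
    a *: (d + k - k^T) + (d' + k' - k'^T).
  by apply/matrixP => i j; rewrite !mxE; ring.
rewrite derive_linear// alg scalerDr mulmxDl; congr (_ + _).
by rewrite scalerA mulrC -scalerA -scalemxAl.
Qed.

Lemma connection_mxB G p v w : differentiable G p ->
  connection_mx G p (v - w) = connection_mx G p v - connection_mx G p w.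
Proof.
by move=> dG; rewrite addrC -scaleN1r connection_mx_linear// scaleN1r addrC.
Qed.

Lemma connection_mx0 G p : differentiable G p -> connection_mx G p 0 = 0.
Proof.
by move=> dG; rewrite -(subrr (0 : 'rV[R]_n)) connection_mxB// subrr.
Qed.

Lemma connection_mx_sum G p v : differentiable G p ->
  connection_mx G p v = \sum_k v 0 k *: connection_mx G p (delta_mx 0 k).
Proof.
move=> dG; rewrite {1}[v]row_sum_delta.
elim/big_rec2 : _ => [|k a b _ IH]; first exact: connection_mx0.
by rewrite connection_mx_linear// IH.
Qed.

Lemma smooth_connection_mx G (B : set 'rV[R]_n) v : open B -> smooth_on B G ->
  (forall p, B p -> G p \in unitmx) -> smooth_on B (fun p => connection_mx G p v).
Proof.
move=> oB sG uG.
have sK : smooth_on B (fun p => koszul_mx G p v).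
  apply/smooth_mxP => // k l; under eq_fun do rewrite mxE.
  have : smooth_on B (fun p => v *m 'D_(delta_mx 0 k) G p).
    by apply: smooth_mulmx => //; [exact: smooth_cst|exact: smooth_derive].
  by move/(smooth_mxP oB)/(_ 0 l).
apply: smooth_mulmx => //; last exact: smooth_invmx.
have sS : smooth_on B (fun p => 'D_v G p + koszul_mx G p v - (koszul_mx G p v)^T).
  apply: smoothD => //; first by apply: smoothD => //; exact: smooth_derive.
  by apply: smoothN => //; exact: smooth_trmx.
apply: (smooth_eq oB (f := fun p => 2%:R^-1%:M *m
    ('D_v G p + koszul_mx G p v - (koszul_mx G p v)^T))) => //.
  by move=> p _; rewrite mul_scalar_mx.
by apply: smooth_mulmx => //; exact: smooth_cst.
Qed.

(** [curvature_mx G p v w] is the matrix of the endomorphism [R(v, w)], in terms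
    of the connection matrices. *)
Definition curvature_mx G p v w : 'M[R]_n :=
  'D_v (fun q => connection_mx G q w) p - 'D_w (fun q => connection_mx G q v) p
  + (connection_mx G p w *m connection_mx G p v
     - connection_mx G p v *m connection_mx G p w).

End ConnectionMatrix.

Section CurvatureAlong.
Context {R : realType} {m n : nat}.
Variables (A : set 'rV[R]_m) (B : set 'rV[R]_n).
Variables (G : 'rV[R]_n -> 'M[R]_n) (F : 'rV[R]_m -> 'rV[R]_n).
Hypotheses (oA : open A) (oB : open B) (FAB : forall u, A u -> B (F u)).
Hypotheses (sF : smooth_on A F) (sG : smooth_on B G).
Hypothesis uG : forall p, B p -> G p \in unitmx.
Implicit Types (X Y : 'rV[R]_m -> 'rV[R]_m) (N : 'rV[R]_m -> 'rV[R]_n).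

Lemma covdE X N u : A u ->
  covd G F X N u = 'D_(X u) N u + N u *m connection_mx G (F u) ('D_(X u) F u).
Proof.
move=> Au; rewrite /covd christoffelE//.
exact: smooth_differentiable sG (FAB Au).
Qed.

Lemma smooth_connection_along (w : 'rV[R]_m -> 'rV[R]_n) : smooth_on A w ->
  smooth_on A (fun u => connection_mx G (F u) (w u)).
Proof.
move=> sw; apply/(smooth_mxP oA) => i j.
have E u : A u -> \sum_k w u 0 k * connection_mx G (F u) (delta_mx 0 k) i j =
    connection_mx G (F u) (w u) i j.
  move=> Au; rewrite [in RHS]connection_mx_sum; last first.
    exact: smooth_differentiable sG (FAB Au).
  by rewrite summxE; apply: eq_bigr => k _; rewrite [RHS]mxE.
apply: (smooth_eq oA E); apply: smooth_sum => // k; apply: smoothM => //.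
  exact: (smooth_mxP oA _).1 sw 0 k.
have sC : smooth_on B (fun p => connection_mx G p (delta_mx 0 k)).
  exact: smooth_connection_mx.
exact: (smooth_mxP oA _).1 (smooth_comp oA oB FAB sF sC) i j.
Qed.

(** The connection matrix is linear in its vector argument, so that its
    derivative along a map splits as that of a product. *)
Lemma derive_connection_along (w : 'rV[R]_m -> 'rV[R]_n) u v :
  smooth_on A w -> A u ->
  'D_v (fun t => connection_mx G (F t) (w t)) u =
  connection_mx G (F u) ('D_v w u) +
  'D_('D_v F u) (fun p => connection_mx G p (w u)) (F u).
Proof.
move=> sw Au; pose C k p := connection_mx G p (delta_mx 0 k).
have sC k : smooth_on B (C k) by exact: smooth_connection_mx.
have dC k p : B p -> differentiable (C k) p by exact: smooth_differentiable.
have dF : differentiable F u by exact: smooth_differentiable Au.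
have dG p : B p -> differentiable G p by exact: smooth_differentiable.
have sCF : smooth_on A (fun t => connection_mx G (F t) (w t)).
  exact: smooth_connection_along.
have sCw : smooth_on B (fun p => connection_mx G p (w u)).
  exact: smooth_connection_mx.
have dw : differentiable w u by exact: smooth_differentiable Au.
have dwk k : differentiable (fun t => w t 0 k : R) u.
  exact: (differentiable_mxP _ _).1 dw 0 k.
have dCij k i j : differentiable (fun p => C k p i j : R) (F u).
  exact: (differentiable_mxP _ _).1 (dC k _ (FAB Au)) i j.
have dCF k i j : differentiable (fun t => C k (F t) i j : R) u.
  exact: differentiable_comp dF (dCij k i j).
apply/matrixP => i j; rewrite [RHS]mxE.
rewrite (derive_mxE _ _ _ (smooth_differentiable sCF Au)).
rewrite (derive_mxE _ _ _ (smooth_differentiable sCw (FAB Au))).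
have E t : A t -> connection_mx G (F t) (w t) i j =
    (\sum_k ((fun t => w t 0 k : R) * (fun t => C k (F t) i j))) t.
  move=> At; rewrite connection_mx_sum; last exact/dG/FAB.
  by rewrite summxE fct_sumE; apply: eq_bigr => k _; rewrite [LHS]mxE.
rewrite (near_eq_derive _ (open_near oA E Au)).
have E' p : B p -> connection_mx G p (w u) i j =
    (\sum_k (w u 0 k \*: (fun p => C k p i j : R))) p.
  move=> Bp; rewrite connection_mx_sum; last exact/dG.
  by rewrite summxE fct_sumE; apply: eq_bigr => k _; rewrite [LHS]mxE.
rewrite (near_eq_derive _ (open_near oB E' (FAB Au))).
rewrite derive_sum; last first.
  by move=> k; apply: diff_derivable; exact: differentiableM.
rewrite derive_sum; last first.
  by move=> k; apply: diff_derivable; exact: differentiableZ.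
rewrite connection_mx_sum; last exact/dG/FAB.
rewrite summxE -big_split /=; apply: eq_bigr => k _.
rewrite deriveM; [|exact/diff_derivable/dwk|exact/diff_derivable/dCF].
rewrite deriveZ; last exact/diff_derivable/dCij.
rewrite (derive_comp v dF (dCij k i j)) addrC; congr (_ + _).
by rewrite [RHS]mxE (derive_mxE _ _ _ dw) /GRing.scale /= mulrC.
Qed.

(** With the derivative of [N] along [X] written as that of the components plus
    the product with a connection matrix, the first derivatives of [N] cancel in
    the commutator, and the second derivatives of [N] and of [F] are turned by
    [derive_bracket] into derivatives along [bracket X Y].  What remains is
    algebraic in [N]. *)
Lemma curvature_along X Y N u :
  smooth_on A X -> smooth_on A Y -> smooth_on A N -> A u ->
  covd G F X (covd G F Y N) u - covd G F Y (covd G F X N) u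
  - covd G F (bracket X Y) N u =
  N u *m curvature_mx G (F u) ('D_(X u) F u) ('D_(Y u) F u).
Proof.
move=> sX sY sN Au.
pose dF (Z : 'rV[R]_m -> 'rV[R]_m) t := 'D_(Z t) F t.
have sdF Z : smooth_on A Z -> smooth_on A (dF Z).
  by move=> sZ; exact: smooth_derive_along.
have sdN Z : smooth_on A Z -> smooth_on A (fun t => 'D_(Z t) N t).
  by move=> sZ; exact: smooth_derive_along.
have dG p : B p -> differentiable G p by exact: smooth_differentiable.
have regroup (a b c d : 'rV[R]_n) (P Q T V : 'M[R]_n) :
    a + (b *m Q + d *m (P + V)) + (c + d *m Q) *m T =
    a + d *m P + (b *m Q + c *m T) + d *m (V + Q *m T).
  rewrite !mulmxDr mulmxDl mulmxA.
  move: (b *m Q) (d *m P) (d *m V) (c *m T) (d *m Q *m T) => x1 x2 x3 x4 x5.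
  by apply/rowP => l; rewrite !mxE; ring.
have covd2 Z W : smooth_on A Z -> smooth_on A W ->
    covd G F Z (covd G F W N) u =
    'D_(Z u) (fun t => 'D_(W t) N t) u
    + N u *m connection_mx G (F u) ('D_(Z u) (dF W) u)
    + ('D_(Z u) N u *m connection_mx G (F u) (dF W u)
       + 'D_(W u) N u *m connection_mx G (F u) (dF Z u))
    + N u *m ('D_(dF Z u) (fun p => connection_mx G p (dF W u)) (F u)
       + connection_mx G (F u) (dF W u) *m connection_mx G (F u) (dF Z u)).
  move=> sZ sW; rewrite (covdE _ _ Au).
  have E t : A t -> covd G F W N t =
      'D_(W t) N t + N t *m connection_mx G (F t) (dF W t) by exact: covdE.
  rewrite (near_eq_derive _ (open_near oA E Au)) E//.
  have sC := smooth_connection_along (sdF W sW).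
  have dC := smooth_differentiable sC Au.
  have dN := smooth_differentiable sN Au.
  rewrite deriveD; last 2 first.
  - by apply: diff_derivable; exact: smooth_differentiable (sdN W sW) Au.
  - by apply: diff_derivable; exact: differentiable_mulmx.
  rewrite (derive_mulmx _ dN dC) (derive_connection_along _ (sdF W sW) Au).
  exact: regroup.
have bracketN : 'D_(bracket X Y u) N u =
    'D_(X u) (fun t => 'D_(Y t) N t) u - 'D_(Y u) (fun t => 'D_(X t) N t) u.
  exact: esym (derive_bracket oA sX sY sN Au).
have bracketF : 'D_(bracket X Y u) F u = 'D_(X u) (dF Y) u - 'D_(Y u) (dF X) u.
  exact: esym (derive_bracket oA sX sY sF Au).
have covd_bracket : covd G F (bracket X Y) N u =
    'D_(X u) (fun t => 'D_(Y t) N t) u - 'D_(Y u) (fun t => 'D_(X t) N t) u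
    + N u *m (connection_mx G (F u) ('D_(X u) (dF Y) u)
              - connection_mx G (F u) ('D_(Y u) (dF X) u)).
  apply: etrans (covdE _ _ Au) _; rewrite bracketN bracketF connection_mxB//.
  exact/dG/FAB.
have cancel (a a' q r d : 'rV[R]_n) (P P' V V' S S' : 'M[R]_n) :
    a + d *m P + (q + r) + d *m (V + S)
    - (a' + d *m P' + (r + q) + d *m (V' + S'))
    - (a - a' + d *m (P - P')) = d *m (V - V' + (S - S')).
  rewrite !mulmxDr !mulmxN.
  move: (d *m P) (d *m P') (d *m V) (d *m V') (d *m S) (d *m S').
  by move=> x1 x2 x3 x4 x5 x6; apply/rowP => l; rewrite !mxE; ring.
have E1 := covd2 X Y sX sY; have E2 := covd2 Y X sY sX.
apply: etrans (congr2 _ (congr2 _ E1 (congr1 _ E2)) (congr1 _ covd_bracket)) _.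
exact: cancel.
Qed.

End CurvatureAlong.

(** The curvature of the ambient space is the case [F = idfun] of
    [curvature_along]. *)
Lemma local_riemannE (R : realType) n (G : 'rV[R]_n -> 'M[R]_n) (B : set 'rV[R]_n)
    (v w z p : 'rV[R]_n) :
  open B -> smooth_on B G -> (forall p, B p -> G p \in unitmx) -> B p ->
  local_riemann G (cst v) (cst w) (cst z) p = z *m curvature_mx G p v w.
Proof.
move=> oB sG uG Bp.
have idB u : B u -> B (idfun u) by [].
apply: etrans (curvature_along oB oB idB (@smooth_id R n B) sG uG
  (smooth_cst v) (smooth_cst w) (smooth_cst z) Bp) _.
have Did c : 'D_c (idfun : 'rV[R]_n -> _) p = c by exact: derive_id.
by rewrite (Did v) (Did w).
Qed.

(** * The Ricci equation *)

Section ConnectionSymmetry.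
Context {R : realType} {n : nat}.
Variables (B : set 'rV[R]_n) (G : 'rV[R]_n -> 'M[R]_n).
Hypotheses (oB : open B) (sG : smooth_on B G).
Hypotheses (symG : forall p, B p -> (G p)^T = G p).
Hypothesis uG : forall p, B p -> G p \in unitmx.

Lemma derive_gram_sym p v : B p -> ('D_v G p)^T = 'D_v G p.
Proof.
move=> Bp; rewrite -derive_trmx; last exact: smooth_differentiable sG Bp.
exact: near_eq_derive (open_near oB symG Bp).
Qed.

(** Vanishing of the torsion: exchanging [v] and [w] exchanges the first two
    terms of Koszul's formula and preserves the third, the derivatives of the
    Gram matrix being symmetric. *)
Lemma connection_mxC p v w : B p ->
  w *m connection_mx G p v = v *m connection_mx G p w.
Proof.
move=> Bp; have dG : differentiable G p by exact: smooth_differentiable sG Bp.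
rewrite /connection_mx !mulmxA; congr (_ *m _).
have mulK x y : x *m koszul_mx G p y = y *m 'D_x G p.
  apply/rowP => l; rewrite derive_row_sum// mulmx_sumr summxE [LHS]mxE.
  by apply: eq_bigr => k _; rewrite -scalemxAr [RHS]mxE [in LHS]mxE.
have mulKT x y : x *m (koszul_mx G p y)^T = y *m (koszul_mx G p x)^T.
  apply/rowP => l; rewrite [LHS]mxE [RHS]mxE.
  have E (z t : 'rV[R]_n) : \sum_j z 0 j * (koszul_mx G p t)^T j l =
      (t *m 'D_(delta_mx 0 l) G p *m z^T) 0 0.
    rewrite [RHS]mxE; apply: eq_bigr => k _; rewrite mulrC.
    by congr (_ * _); rewrite !mxE.
  rewrite (E x y) (E y x); set D := 'D_ _ _ _.
  have DT : D^T = D by exact: derive_gram_sym.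
  rewrite -[in LHS](trmxK (y *m D *m x^T)) mxE !trmx_mul trmxK DT mulmxA.
  by [].
rewrite -!scalemxAr; congr (_ *: _).
have := mulKT w v; have := mulK v w; have := mulK w v.
move: ('D_v G p) ('D_w G p) (koszul_mx G p v) (koszul_mx G p w).
by move=> d d' k k' E1 E2 E3; rewrite !mulmxBr !mulmxDr E1 E2 E3 [w *m d + _]addrC.
Qed.

(** Metricity: the last two terms of Koszul's formula are antisymmetric and
    cancel against their transposes. *)
Lemma connection_mx_compat p v : B p ->
  'D_v G p = connection_mx G p v *m G p + G p *m (connection_mx G p v)^T.
Proof.
move=> Bp; have uGp := uG Bp.
have CG : connection_mx G p v *m G p =
    2%:R^-1 *: ('D_v G p + koszul_mx G p v - (koszul_mx G p v)^T).
  by rewrite /connection_mx mulmxKV.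
have GC : G p *m (connection_mx G p v)^T = (connection_mx G p v *m G p)^T.
  by rewrite [RHS]trmx_mul (symG Bp).
rewrite GC CG; have := derive_gram_sym v Bp.
move: ('D_v G p) (koszul_mx G p v) => D k DT.
by apply/matrixP => i j; move/matrixP: DT => /(_ i j); rewrite !mxE => ->; field.
Qed.

End ConnectionSymmetry.

Section NormalPart.
Context {R : realType} {m n : nat}.
Variables (A : 'M[R]_n) (J : 'M[R]_(m, n)).
Hypotheses (symA : A^T = A) (uA : A \in unitmx).
Hypothesis uP : J *m A *m J^T \in unitmx.

Lemma normalD v w : normal A J (v + w) = normal A J v + normal A J w.
Proof. by rewrite /normal /tangential !mulmxDl opprD addrACA. Qed.

Lemma normalN v : normal A J (- v) = - normal A J v.
Proof. by rewrite /normal /tangential !mulNmx opprD. Qed.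

Lemma normalB v w : normal A J (v - w) = normal A J v - normal A J w.
Proof. by rewrite normalD normalN. Qed.

Lemma normal_tangent (z : 'rV[R]_m) : normal A J (z *m J) = 0.
Proof.
by rewrite /normal /tangential -2!(mulmxA z) mulmxK// subrr.
Qed.

Lemma normal_mod_tangent v (z : 'rV[R]_m) w :
  normal A J (v - (z *m J + w)) = normal A J (v - w).
Proof.
by rewrite opprD addrCA normalD normalN normal_tangent oppr0 add0r.
Qed.

Lemma normal_orthogonal v : normal A J v *m A *m J^T = 0.
Proof.
have E : tangential A J v *m J *m A *m J^T =
    tangential A J v *m (J *m A *m J^T) by rewrite !mulmxA.
by rewrite /normal !mulmxBl E /tangential mulmxKV// subrr.
Qed.

Lemma normal_id w : w *m A *m J^T = 0 -> normal A J w = w.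
Proof. by move=> w0; rewrite /normal /tangential w0 !mul0mx subr0. Qed.

Lemma tangent_inner_normal (z : 'rV[R]_m) w : w *m A *m J^T = 0 ->
  inner A (z *m J) w = 0.
Proof. by move=> w0; rewrite inner_sym// inner_mulmx w0 mul0mx mxE. Qed.

Lemma inner_normal v w : w *m A *m J^T = 0 ->
  inner A (normal A J v) w = inner A v w.
Proof. by move=> w0; rewrite innerBl tangent_inner_normal// subr0. Qed.

(** The ambient form is nondegenerate on the normal space: a normal vector
    orthogonal to all normal vectors is orthogonal to the tangent space too,
    hence to every vector. *)
Lemma normal_eq0P v : normal A J v = 0 <->
  forall w, w *m A *m J^T = 0 -> inner A v w = 0.
Proof.
split=> [v0 w w0|v0]; first by rewrite -inner_normal// v0 /inner !mul0mx mxE.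
have nv := normal_orthogonal v.
have orth w : inner A (normal A J v) w = 0.
  rewrite -(subrK (tangential A J w *m J) w) innerDr -/(normal A J w).
  rewrite inner_normal; last exact: normal_orthogonal.
  by rewrite v0 ?normal_orthogonal// inner_mulmx nv mul0mx mxE addr0.
have nA0 : normal A J v *m A = 0.
  by apply/rowP => l; rewrite -inner_delta orth mxE.
by rewrite -(mulmxK uA (normal A J v)) nA0 mul0mx.
Qed.

End NormalPart.

Section Ricci.
Context {R : realType} {m n : nat}.
Variables (A : set 'rV[R]_m) (B : set 'rV[R]_n).
Variables (G : 'rV[R]_n -> 'M[R]_n) (F : 'rV[R]_m -> 'rV[R]_n).
Hypotheses (oA : open A) (oB : open B) (FAB : forall u, A u -> B (F u)).
Hypotheses (sF : smooth_on A F) (sG : smooth_on B G).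
Hypotheses (symG : forall p, B p -> (G p)^T = G p).
Hypothesis uG : forall p, B p -> G p \in unitmx.
Hypothesis uP : forall u, A u -> 'J F u *m G (F u) *m ('J F u)^T \in unitmx.
Implicit Types (X Y Z : 'rV[R]_m -> 'rV[R]_m) (N : 'rV[R]_m -> 'rV[R]_n).

(** The rows of [hessian_mx u x] are the covariant derivatives along [x] of the
    coordinate tangent fields. *)
Definition hessian_mx u (x : 'rV[R]_m) : 'M[R]_(m, n) :=
  'D_x (fun t => 'J F t) u + 'J F u *m connection_mx G (F u) (x *m 'J F u).

Let dJ u : A u -> differentiable (fun t => 'J F t) u.
Proof. by move=> Au; apply: smooth_differentiable Au; exact: smooth_jacobian. Qed.

Let dF u : A u -> differentiable F u.
Proof. by move=> Au; exact: smooth_differentiable Au. Qed.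

Let dG p : B p -> differentiable G p.
Proof. by move=> Bp; exact: smooth_differentiable Bp. Qed.

(** Symmetry of the second fundamental form: Schwarz's theorem for [F] and the
    vanishing of the torsion. *)
Lemma hessian_mxC u x z : A u -> z *m hessian_mx u x = x *m hessian_mx u z.
Proof.
move=> Au; rewrite /hessian_mx !mulmxDr !(mulmxA _ (jacobian F u)).
rewrite (derive_jacobian_swap x z oA sF Au).
by rewrite (connection_mxC oB sG symG _ _ (FAB Au)).
Qed.

Lemma smooth_covd X N : smooth_on A X -> smooth_on A N ->
  smooth_on A (covd G F X N).
Proof.
move=> sX sN; have sDF := smooth_derive_along oA sX sF.
have E u : A u -> 'D_(X u) N u + N u *m connection_mx G (F u) ('D_(X u) F u) =
    covd G F X N u by move=> Au; rewrite (covdE FAB sG).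
apply: (smooth_eq oA E); apply: smoothD => //.
  exact: smooth_derive_along.
by apply: smooth_mulmx => //; exact: (smooth_connection_along oA oB FAB sF sG uG).
Qed.

Lemma covdB X N N' u : A u -> differentiable N u -> differentiable N' u ->
  covd G F X (fun t => N t - N' t) u = covd G F X N u - covd G F X N' u.
Proof.
move=> Au dN dN'; rewrite !(covdE FAB sG _ _ Au).
rewrite deriveB; [|exact/diff_derivable/dN|exact/diff_derivable/dN'].
by rewrite mulmxBl opprD addrACA.
Qed.

Lemma covd_tangent X Z u : smooth_on A Z -> A u ->
  covd G F X (fun t => Z t *m 'J F t) u =
  'D_(X u) Z u *m 'J F u + Z u *m hessian_mx u (X u).
Proof.
move=> sZ Au; rewrite (covdE FAB sG _ _ Au).
rewrite (derive_mulmx _ (smooth_differentiable sZ Au) (dJ Au)).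
rewrite (deriveEjacobian _ (dF Au)) /hessian_mx mulmxDr.
by rewrite (mulmxA _ (jacobian F u)) addrA.
Qed.

Definition normal_on N := forall u, A u -> N u *m G (F u) *m ('J F u)^T = 0.

(** Differentiating the orthogonality of [N] to the tangent space expresses the
    tangential part of the derivative of [N] by the value of [N]. *)
Lemma covd_normal X N u : smooth_on A N -> normal_on N -> A u ->
  covd G F X N u *m G (F u) *m ('J F u)^T =
  - (N u *m G (F u) *m (hessian_mx u (X u))^T).
Proof.
move=> sN nN Au; have dN := smooth_differentiable sN Au.
have dFu := dF Au; have dGF := dG (FAB Au); have dJu := dJ Au.
have dGFu : differentiable (G \o F) u by exact: differentiable_comp.
have dNG := differentiable_mulmx dN dGFu.
have : 'D_(X u) (fun t => N t *m (G \o F) t *m ('J F t)^T) u = 0.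
  rewrite (near_eq_derive _ (open_near oA (g := cst 0) nN Au)); exact: derive_cst.
rewrite (derive_mulmx _ dNG (differentiable_trmx dJu)) (derive_mulmx _ dN dGFu).
rewrite (derive_trmx _ dJu) (derive_comp _ dFu dGF).
rewrite (connection_mx_compat oB sG symG uG _ (FAB Au)).
rewrite (covdE FAB sG _ _ Au) /hessian_mx -(deriveEjacobian _ dFu) /=.
move: ('D_(X u) N u) (connection_mx _ _ _) ('D_(X u) _ u) (G (F u)) ('J F u).
move=> n' c j' g j E; apply/eqP; rewrite -addr_eq0 -[X in _ == X]E; apply/eqP.
rewrite linearD /= trmx_mul !mulmxDr !mulmxDl !mulmxA -!addrA; congr (_ + _).
by congr (_ + _); rewrite addrC.
Qed.

(** The second fundamental form along the normal vector [w], as a symmetric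
    matrix of scalars; the Weingarten operator is obtained from it by raising an
    index with the first fundamental form ([tangential_covd]). *)
Definition shape_mx u (w : 'rV[R]_n) : 'M[R]_m :=
  \matrix_(a, b) (w *m G (F u) *m (hessian_mx u (delta_mx 0 b))^T) 0 a.

Lemma shape_mx_linear u a w w' :
  shape_mx u (a *: w + w') = a *: shape_mx u w + shape_mx u w'.
Proof.
by apply/matrixP => i j; rewrite [LHS]mxE !mulmxDl -!scalemxAl !mxE.
Qed.

Lemma shape_mxE u w x : A u ->
  x *m shape_mx u w = w *m G (F u) *m (hessian_mx u x)^T.
Proof.
move=> Au; apply/rowP => b; rewrite [LHS]mxE.
have <- : (w *m G (F u) *m (x *m hessian_mx u (delta_mx 0 b))^T) 0 0 =
    \sum_a x 0 a * shape_mx u w a b.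
  rewrite trmx_mul mulmxA [LHS]mxE; apply: eq_bigr => a _.
  by rewrite mulrC [x^T a 0]mxE [shape_mx _ _ _ _]mxE.
by rewrite hessian_mxC// trmx_mul mulmxA trmx_delta -colE mxE.
Qed.

Lemma shape_mx_sym u w : A u -> (shape_mx u w)^T = shape_mx u w.
Proof.
move=> Au.
have E a b : shape_mx u w a b =
    (w *m G (F u) *m ((delta_mx 0 a : 'rV_m) *m hessian_mx u (delta_mx 0 b))^T) 0 0.
  by rewrite trmx_mul mulmxA trmx_delta -colE [RHS]mxE [LHS]mxE.
by apply/matrixP => a b; rewrite mxE !E hessian_mxC.
Qed.

Lemma inner_hessian u w x z : A u ->
  inner (G (F u)) (z *m hessian_mx u x) w = (x *m shape_mx u w *m z^T) 0 0.
Proof.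
move=> Au; rewrite inner_sym; last exact/symG/FAB.
by rewrite inner_mulmx shape_mxE.
Qed.

Lemma tangential_covd X N u : smooth_on A N -> normal_on N -> A u ->
  tangential (G (F u)) ('J F u) (covd G F X N u) =
  - (X u *m shape_mx u (N u)
     *m invmx ('J F u *m G (F u) *m ('J F u)^T)).
Proof.
by move=> sN nN Au; rewrite /tangential covd_normal// shape_mxE// mulNmx.
Qed.

(** The Ricci equation: writing the ambient derivative of a normal field as its
    normal derivative plus a tangent field, and differentiating once more, the
    tangent field contributes its second fundamental form. *)
Lemma ricci_equation X Y N u : smooth_on A X -> smooth_on A Y ->
  smooth_on A N -> normal_on N -> A u ->
  let L := shape_mx u (N u) *m invmx ('J F u *m G (F u) *m ('J F u)^T) in
  local_normal_curvature G F X Y N u =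
  normal (G (F u)) ('J F u)
    (N u *m curvature_mx G (F u) ('D_(X u) F u) ('D_(Y u) F u)
     + (Y u *m L *m hessian_mx u (X u) - X u *m L *m hessian_mx u (Y u))).
Proof.
move=> sX sY sN nN Au L.
have sJ := smooth_jacobian oA sF.
have sGF : smooth_on A (fun t => G (F t)) by exact: smooth_comp sG.
have uPu := uP Au.
pose T Z t := tangential (G (F t)) ('J F t) (covd G F Z N t).
have sT Z : smooth_on A Z -> smooth_on A (T Z).
  move=> sZ; have sJT := smooth_trmx oA sJ.
  apply: smooth_mulmx => //.
    apply: smooth_mulmx => //; apply: smooth_mulmx => //.
    exact: smooth_covd.
  apply: smooth_invmx => //; apply: smooth_mulmx => //.
  exact: smooth_mulmx.
have step Z W : smooth_on A Z -> smooth_on A W ->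
    normal_covd G F Z (normal_covd G F W N) u =
    normal (G (F u)) ('J F u)
      (covd G F Z (covd G F W N) u + W u *m L *m hessian_mx u (Z u)).
  move=> sZ sW.
  have TW : T W u = - (W u *m L).
    by rewrite /L mulmxA; exact: tangential_covd.
  have sTJ : smooth_on A (fun t => T W t *m 'J F t).
    by apply: smooth_mulmx => //; exact: sT.
  have E : covd G F Z (normal_covd G F W N) u =
      covd G F Z (covd G F W N) u - covd G F Z (fun t => T W t *m 'J F t) u.
    have dcov := smooth_differentiable (smooth_covd sW sN) Au.
    exact: covdB Au dcov (smooth_differentiable sTJ Au).
  rewrite /normal_covd E (covd_tangent _ (sT W sW) Au).
  by rewrite normal_mod_tangent// TW mulNmx opprK.
have regroup (a b c d e : 'rV[R]_n) :
    normal (G (F u)) ('J F u) (a + d) - normal (G (F u)) ('J F u) (b + e)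
    - normal (G (F u)) ('J F u) c =
    normal (G (F u)) ('J F u) (a - b - c + (d - e)).
  rewrite -!normalB; congr normal.
  by apply/rowP => l; rewrite !mxE; ring.
have E1 := step X Y sX sY; have E2 := step Y X sY sX.
have C := curvature_along oA oB FAB sF sG uG sX sY sN Au.
by rewrite /local_normal_curvature E1 E2 -C; exact: regroup.
Qed.

(** In the Ricci equation the difference of the two curvatures is a normal vector;
    its inner product with a normal vector [M] is the antisymmetric part, in
    [X u] and [Y u], of the product of the second fundamental forms along [M] and
    [N u], an index being raised by the inverse [P'] of the first one. *)
Lemma ricci_defect X Y N u : smooth_on A X -> smooth_on A Y ->
  smooth_on A N -> normal_on N -> A u ->
  let P' := invmx ('J F u *m G (F u) *m ('J F u)^T) in
  local_normal_curvature G F X Y N u =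
  normal (G (F u)) ('J F u)
    (N u *m curvature_mx G (F u) (X u *m 'J F u) (Y u *m 'J F u)) <->
  forall M : 'rV[R]_n, M *m G (F u) *m ('J F u)^T = 0 ->
    X u *m (shape_mx u M *m P' *m shape_mx u (N u)) *m (Y u)^T =
    Y u *m (shape_mx u M *m P' *m shape_mx u (N u)) *m (X u)^T.
Proof.
move=> sX sY sN nN Au P'.
have uPu := uP Au; have uGu := uG (FAB Au); have symGu := symG (FAB Au).
have P'T : P'^T = P'.
  by rewrite /P' trmx_inv !trmx_mul trmxK symGu mulmxA.
have LE := ricci_equation sX sY sN nN Au.
rewrite !(deriveEjacobian _ (dF Au)) -/P' in LE; rewrite LE normalD => {LE}.
set D := (X in normal _ _ _ + normal _ _ X).
have defect (a b : 'rV[R]_n) : a + b = a <-> b = 0.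
  split=> [/eqP|->]; last by rewrite addr0.
  by rewrite -subr_eq0 addrAC subrr add0r => /eqP.
apply: iff_trans (defect _ _) _.
have DE M : inner (G (F u)) D M =
    (X u *m (shape_mx u M *m P' *m shape_mx u (N u)) *m (Y u)^T) 0 0
    - (Y u *m (shape_mx u M *m P' *m shape_mx u (N u)) *m (X u)^T) 0 0.
  have trE (x y : 'rV[R]_m) :
      x *m shape_mx u M *m (y *m (shape_mx u (N u) *m P'))^T =
      x *m (shape_mx u M *m P' *m shape_mx u (N u)) *m y^T.
    by rewrite !trmx_mul P'T (shape_mx_sym _ Au) !mulmxA.
  by rewrite /D innerBl !(inner_hessian _ _ _ Au) !trE.
apply: iff_trans (normal_eq0P symGu uGu uPu D) _.
split=> H M nM; have := H M nM.
  by rewrite DE => /eqP; rewrite subr_eq0 => /eqP E; apply/matrixP=> i j; rewrite !ord1.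
by move=> E; rewrite DE E subrr.
Qed.

(** [local_shape_tensor] is opposite to the normal part of [hessian_mx], whence
    the sign. *)
Lemma inner_mean_curvature w u : A u -> w *m G (F u) *m ('J F u)^T = 0 ->
  inner (G (F u)) (local_mean_curvature G F u) w =
  - \tr (shape_mx u w *m invmx ('J F u *m G (F u) *m ('J F u)^T)).
Proof.
move=> Au nw; rewrite /local_mean_curvature.
set P' := invmx _.
have innerS (I : finType) (f : I -> 'rV[R]_n) :
    inner (G (F u)) (\sum_i f i) w = \sum_i inner (G (F u)) (f i) w.
  elim/big_rec2 : _ => [|i x y _ <-]; last by rewrite innerDl.
  by rewrite /inner !mul0mx mxE.
have P'T : P'^T = P'.
  by rewrite /P' trmx_inv !trmx_mul trmxK (symG (FAB Au)) mulmxA.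
have E a b : inner (G (F u))
    (local_shape_tensor G F (cst (delta_mx 0 a)) (cst (delta_mx 0 b)) u) w =
    - shape_mx u w a b.
  have symGu := symG (FAB Au).
  rewrite /local_shape_tensor /normal_covd innerNl.
  rewrite (covd_tangent _ (smooth_cst _) Au) derive_cst mul0mx add0r.
  rewrite inner_normal// inner_hessian//.
  by rewrite trmx_delta -rowE -colE !mxE.
rewrite innerS /mxtrace -sumrN; apply: eq_bigr => a _.
rewrite innerS mxE -sumrN; apply: eq_bigr => b _.
have P'C : P' a b = P' b a by rewrite -{1}P'T mxE.
by rewrite innerZl E P'C mulrN mulrC.
Qed.

End Ricci.

(** The coefficient in the definition of umbilical points is half a trace; in
    dimension two it is therefore the proportionality factor as soon as the two
    fundamental forms are proportional. *)
Lemma local_umbilicalP (R : realType) n (A : set 'rV[R]_2) (B : set 'rV[R]_n)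
    (G : 'rV[R]_n -> 'M[R]_n) (F : 'rV[R]_2 -> 'rV[R]_n)
    (N : 'rV[R]_2 -> 'rV[R]_n) u :
  open A -> open B -> (forall u, A u -> B (F u)) ->
  smooth_on A F -> smooth_on B G -> (forall p, B p -> (G p)^T = G p) ->
  (forall p, B p -> G p \in unitmx) ->
  (forall u, A u -> 'J F u *m G (F u) *m ('J F u)^T \in unitmx) ->
  smooth_on A N -> normal_on A G F N -> A u ->
  (forall v, local_weingarten G F N (cst v) u =
     (2%:R^-1 * inner (G (F u)) (local_mean_curvature G F u) (N u)) *: v) <->
  exists c, shape_mx G F u (N u) = c *: ('J F u *m G (F u) *m ('J F u)^T).
Proof.
move=> oA oB FAB sF sG symG uG uP sN nN Au; have uPu := uP u Au.
rewrite (inner_mean_curvature oA oB FAB sF sG symG Au (nN u Au)).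
have WE v : local_weingarten G F N (cst v) u =
    - (v *m (shape_mx G F u (N u) *m invmx ('J F u *m G (F u) *m ('J F u)^T))).
  have T := tangential_covd oA oB FAB sF sG symG uG (cst v) sN nN Au.
  exact: etrans T (congr1 _ (esym (mulmxA _ _ _))).
move: (shape_mx _ _ _ _) ('J F u *m _ *m _) uPu WE => K P uP' WE.
split=> [H|[c E] v].
  set c := 2%:R^-1 * _ in H; exists (- c).
  rewrite -[K](mulmxKV uP'); have -> : K *m invmx P = - c%:M.
    by apply/row_matrixP => i; rewrite !rowE -[LHS]opprK -WE H mulmxN mul_mx_scalar.
  by rewrite mulNmx mul_scalar_mx scaleNr.
rewrite WE E -scalemxAl mulmxV// mxtraceZ mxtrace1 mulrN -scalemxAr mulmx1 scaleNr.
by congr (- (_ *: _)); field.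
Qed.

(** * Pencils of symmetric forms in two variables *)

Section Pencil.
Context {R : fieldType}.
Implicit Types P K L : 'M[R]_2.

(** The determinant of the three forms in the coordinates given by their entries
    of indices [(0, 0)], [(0, 1)] and [(1, 1)]. *)
Definition triple_det P K L : R :=
  P 0 0 * (K 0 1 * L 1 1 - K 1 1 * L 0 1)
  - P 0 1 * (K 0 0 * L 1 1 - K 1 1 * L 0 0)
  + P 1 1 * (K 0 0 * L 0 1 - K 0 1 * L 0 0).

Lemma mulmx2E m n (A : 'M[R]_(m, 2)) (B : 'M[R]_(2, n)) i j :
  (A *m B) i j = A i 0 * B 0 j + A i 1 * B 1 j.
Proof.
rewrite mxE !big_ord_recl big_ord0 addr0.
by congr (_ + _ i _ * B _ _); exact: val_inj.
Qed.

Lemma ord2P (Q : 'I_2 -> Prop) : Q 0 -> Q 1 -> forall i, Q i.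
Proof.
by move=> Q0 Q1 [[|[|//]] i2]; [move: Q0|move: Q1]; congr Q; exact: val_inj.
Qed.

Lemma sym2 P : P^T = P -> P 1 0 = P 0 1.
Proof. by move=> PT; rewrite -[in LHS]PT mxE. Qed.

(** The product [K *m invmx P *m L] is symmetric when the endomorphisms defined
    by [K] and [L] relatively to [P] commute.  In dimension two its antisymmetric
    part is a single number which, the inverse of [P] being proportional to its
    adjugate, is a nonzero multiple of the determinant. *)
Lemma triple_detP P K L : P \in unitmx -> P^T = P -> K^T = K -> L^T = L ->
  (forall x y : 'rV[R]_2, x *m (K *m invmx P *m L) *m y^T =
                          y *m (K *m invmx P *m L) *m x^T) <->
  triple_det P K L = 0.
Proof.
move=> uP PT KT LT.
have [[P10 K10] L10] := (sym2 PT, sym2 KT, sym2 LT).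
(* [Q] is the adjugate of [P]. *)
pose Q : 'M[R]_2 := \matrix_(i, j)
  if i == j then (if i == 0 then P 1 1 else P 0 0) else - P i j.
have Q00 : Q 0 0 = P 1 1 by rewrite mxE.
have Q01 : Q 0 1 = - P 0 1 by rewrite mxE.
have Q10 : Q 1 0 = - P 0 1 by rewrite mxE /= P10.
have Q11 : Q 1 1 = P 0 0 by rewrite mxE.
pose d := P 0 0 * P 1 1 - P 0 1 * P 0 1.
have PQ : P *m Q = d%:M.
  apply/matrixP; apply: ord2P; apply: ord2P; rewrite mulmx2E [RHS]mxE /= /d;
  by rewrite ?Q00 ?Q01 ?Q10 ?Q11 ?P10 ?mulr1n ?mulr0n; ring.
have d0 : d != 0.
  apply/eqP => d0; have Q0 : Q = 0.
    by rewrite -(mulKmx uP Q) PQ d0 -scalemx1 scale0r mulmx0.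
  have P00 : P 0 0 = 0 by rewrite -Q11 Q0 mxE.
  have P01 : P 0 1 = 0 by rewrite -[LHS]opprK -Q01 Q0 mxE oppr0.
  have := congr1 (fun M : 'M[R]_2 => M 0 0) (mulmxV uP).
  by rewrite mulmx2E P00 P01 !mul0r addr0 mxE => /eqP; rewrite eq_sym oner_eq0.
have P'E : invmx P = d^-1 *: Q.
  rewrite -[RHS](mulKmx uP) -scalemxAr PQ -scalemx1 scalerA mulVf// scale1r.
  by rewrite mulmx1.
set M := K *m invmx P *m L.
have ME : M 0 1 - M 1 0 = d^-1 * triple_det P K L.
  have -> : M = d^-1 *: (K *m Q *m L).
    by rewrite /M P'E -scalemxAr -scalemxAl.
  rewrite [X in X - _]mxE [X in _ - X]mxE -mulrBr; congr (_ * _).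
  rewrite !mulmx2E Q00 Q01 Q10 Q11 K10 L10 /triple_det; ring.
have xMy (x y : 'rV[R]_2) : x *m M *m y^T - y *m M *m x^T =
    ((x 0 0 * y 0 1 - x 0 1 * y 0 0) * (M 0 1 - M 1 0))%:M.
  have E (z w : 'rV[R]_2) : (z *m M *m w^T) 0 0 =
     (z 0 0 * M 0 0 + z 0 1 * M 1 0) * w 0 0
     + (z 0 0 * M 0 1 + z 0 1 * M 1 1) * w 0 1.
    by rewrite mulmx2E mulmx2E [(z *m M) 0 1]mulmx2E !mxE.
  apply/matrixP => i j; rewrite !ord1 [RHS]mxE eqxx mulr1n [LHS]mxE [X in _ + X]mxE.
  by rewrite (E x y) (E y x); ring.
split=> [H|T0 x y]; last first.
  by apply/eqP; rewrite -subr_eq0 xMy ME T0 !mulr0 -scalemx1 scale0r.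
have := congr1 (fun Z : 'M[R]_1 => Z 0 0) (xMy (delta_mx 0 0) (delta_mx 0 1)).
rewrite H subrr ME !mxE /= !(mulr1n, mulr0n, mulr1, mulr0, subr0, mul1r) => /esym/eqP.
by rewrite mulf_eq0 invr_eq0 (negbTE d0) => /eqP.
Qed.

(** Each coefficient times the determinant is a combination of the entries of the
    vanishing sum, by multilinearity. *)
Lemma triple_det_dependent P K L a b c :
  a *: P + b *: K + c *: L = 0 -> (a != 0) || (b != 0) || (c != 0) ->
  triple_det P K L = 0.
Proof.
move=> H nz; have E i j : a * P i j + b * K i j + c * L i j = 0.
  by move/matrixP: H => /(_ i j); rewrite !mxE.
have [E00 E01 E11] := And3 (E 0 0) (E 0 1) (E 1 1).
have mul0 x : x != 0 -> x * triple_det P K L = 0 -> triple_det P K L = 0.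
  by move=> x0 /eqP; rewrite mulf_eq0 (negbTE x0) => /eqP.
case/orP: nz => [/orP[a0|b0]|c0].
- apply: (mul0 a a0); transitivity (
    (a * P 0 0 + b * K 0 0 + c * L 0 0) * (K 0 1 * L 1 1 - K 1 1 * L 0 1)
    - (a * P 0 1 + b * K 0 1 + c * L 0 1) * (K 0 0 * L 1 1 - K 1 1 * L 0 0)
    + (a * P 1 1 + b * K 1 1 + c * L 1 1) * (K 0 0 * L 0 1 - K 0 1 * L 0 0)).
    by rewrite /triple_det; ring.
  by rewrite E00 E01 E11; ring.
- apply: (mul0 b b0); transitivity (
    (a * P 0 0 + b * K 0 0 + c * L 0 0) * (L 0 1 * P 1 1 - L 1 1 * P 0 1)
    - (a * P 0 1 + b * K 0 1 + c * L 0 1) * (L 0 0 * P 1 1 - L 1 1 * P 0 0)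
    + (a * P 1 1 + b * K 1 1 + c * L 1 1) * (L 0 0 * P 0 1 - L 0 1 * P 0 0)).
    by rewrite /triple_det; ring.
  by rewrite E00 E01 E11; ring.
- apply: (mul0 c c0); transitivity (
    (a * P 0 0 + b * K 0 0 + c * L 0 0) * (P 0 1 * K 1 1 - P 1 1 * K 0 1)
    - (a * P 0 1 + b * K 0 1 + c * L 0 1) * (P 0 0 * K 1 1 - P 1 1 * K 0 0)
    + (a * P 1 1 + b * K 1 1 + c * L 1 1) * (P 0 0 * K 0 1 - P 0 1 * K 0 0)).
    by rewrite /triple_det; ring.
  by rewrite E00 E01 E11; ring.
Qed.

Lemma sym2_eq K L : K^T = K -> L^T = L ->
  K 0 0 = L 0 0 -> K 0 1 = L 0 1 -> K 1 1 = L 1 1 -> K = L.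
Proof.
move=> KT LT E0 E1 E2; apply/matrixP; apply: ord2P; apply: ord2P => //.
by rewrite (sym2 KT) (sym2 LT).
Qed.

(** Either [K] is a multiple of [P], or one of the coordinates of the cross
    product of [P] and [K] is nonzero and is then the coefficient of [L] in the
    linear relation given by Cramer's rule. *)
Lemma triple_det_relation P K L : P != 0 -> P^T = P -> K^T = K -> L^T = L ->
  triple_det P K L = 0 ->
  (exists c, K = c *: P) \/
  exists a b c, c != 0 /\ b *: K + c *: L = a *: P.
Proof.
move=> Pn0 PT KT LT; rewrite /triple_det => T0.
have combT a b (X Y : 'M[R]_2) : X^T = X -> Y^T = Y ->
    (a *: X + b *: Y)^T = a *: X + b *: Y.
  by move=> XT YT; rewrite linearD !linearZ /= XT YT.
have scaleT a (X : 'M[R]_2) : X^T = X -> (a *: X)^T = a *: X.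
  by move=> XT; rewrite linearZ /= XT.
have [c0|] := eqVneq (P 0 1 * K 1 1 - P 1 1 * K 0 1) 0; last first.
  move=> c0; right.
  exists (- (K 0 1 * L 1 1 - K 1 1 * L 0 1)), (L 0 1 * P 1 1 - L 1 1 * P 0 1).
  exists (P 0 1 * K 1 1 - P 1 1 * K 0 1); split=> //.
  apply: (sym2_eq (combT _ _ _ _ KT LT) (scaleT _ _ PT)); rewrite !mxE.
  - by apply/eqP; rewrite -subr_eq0 -T0; apply/eqP; ring.
  - by ring.
  - by ring.
have [c1|] := eqVneq (P 0 0 * K 1 1 - P 1 1 * K 0 0) 0; last first.
  move=> c1; right.
  exists (- (K 0 0 * L 1 1 - K 1 1 * L 0 0)), (L 0 0 * P 1 1 - L 1 1 * P 0 0).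
  exists (P 0 0 * K 1 1 - P 1 1 * K 0 0); split=> //.
  apply: (sym2_eq (combT _ _ _ _ KT LT) (scaleT _ _ PT)); rewrite !mxE.
  - by ring.
  - by apply/eqP; rewrite -subr_eq0 -oppr_eq0 -T0; apply/eqP; ring.
  - by ring.
have [c2|] := eqVneq (P 0 0 * K 0 1 - P 0 1 * K 0 0) 0; last first.
  move=> c2; right.
  exists (- (K 0 0 * L 0 1 - K 0 1 * L 0 0)), (L 0 0 * P 0 1 - L 0 1 * P 0 0).
  exists (P 0 0 * K 0 1 - P 0 1 * K 0 0); split=> //.
  apply: (sym2_eq (combT _ _ _ _ KT LT) (scaleT _ _ PT)); rewrite !mxE.
  - by ring.
  - by ring.
  - by apply/eqP; rewrite -subr_eq0 -T0; apply/eqP; ring.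
left.
have ratio i j k l : P i j != 0 -> P i j * K k l - P k l * K i j = 0 ->
    K k l = K i j / P i j * P k l.
  move=> p0 /eqP; rewrite subr_eq0 => /eqP E.
  by rewrite mulrAC -[K i j * _]mulrC -E mulrAC divff// mul1r.
have swap i j k l : P i j * K k l - P k l * K i j = 0 ->
    P k l * K i j - P i j * K k l = 0 by move=> E; rewrite -opprB E oppr0.
have same i j : P i j * K i j - P i j * K i j = 0 by rewrite subrr.
suff [i [j [p0 [r0 r1 r2]]]] : exists i j, P i j != 0 /\
    [/\ P i j * K 0 0 - P 0 0 * K i j = 0, P i j * K 0 1 - P 0 1 * K i j = 0
      & P i j * K 1 1 - P 1 1 * K i j = 0].
  exists (K i j / P i j); apply: (sym2_eq KT (scaleT _ _ PT)).
  - by rewrite mxE; exact: ratio.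
  - by rewrite mxE; exact: ratio.
  - by rewrite mxE; exact: ratio.
have [p00|p0] := eqVneq (P 0 0) 0; last first.
  by exists 0, 0; split.
have [p01|p1] := eqVneq (P 0 1) 0; last first.
  by exists 0, 1; split=> //; split=> //; exact: swap.
exists 1, 1; split; last by split=> //; exact: swap.
apply: contra Pn0 => /eqP p11; apply/eqP.
by apply: (sym2_eq PT (trmx0 _ _ _)); rewrite ?p00 ?p01 ?p11 mxE.
Qed.

Lemma three_in_plane m n (U : 'M[R]_(m, n)) (x y z : 'rV[R]_n) : \rank U = 2 ->
  (x <= U)%MS -> (y <= U)%MS -> (z <= U)%MS ->
  exists a b c, (a != 0) || (b != 0) || (c != 0) /\ a *: x + b *: y + c *: z = 0.
Proof.
move=> rU xU yU zU; pose A := col_mx x (col_mx y z).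
have AU : (A <= U)%MS by rewrite !col_mx_sub xU yU zU.
have nfA : ~~ row_free A.
  by rewrite /row_free; apply/negP => /eqP rA; have := mxrankS AU; rewrite rA rU.
have : kermx A != 0 by apply: contra nfA; rewrite kermx_eq0.
move=> /rowV0Pn[v vA v0]; have {vA} vA : v *m A = 0 by apply/sub_kermxP.
pose a := lsubmx v; pose b := lsubmx (rsubmx v); pose c := rsubmx (rsubmx v).
have vE : v = row_mx a (row_mx b c) by rewrite !hsubmxK.
exists (a 0 0), (b 0 0), (c 0 0); split; last first.
  move: vA; rewrite vE !mul_row_col [a]mx11_scalar [b]mx11_scalar [c]mx11_scalar.
  by rewrite !mul_scalar_mx !mxE eqxx !mulr1n addrA.
apply: contraR v0; rewrite !negb_or !negbK => /andP[/andP[/eqP a0 /eqP b0] /eqP c0].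
rewrite vE [a]mx11_scalar [b]mx11_scalar [c]mx11_scalar a0 b0 c0.
by rewrite -scalemx1 scale0r !row_mx0.
Qed.

Lemma plane_basis n (U : 'M[R]_n) : \rank U = 2 ->
  exists x y : 'rV[R]_n, [/\ (x <= U)%MS, (y <= U)%MS, x != 0 &
    forall a b, a *: x + b *: y = 0 -> b = 0].
Proof.
move=> rU.
have : exists Z : 'M[R]_(\rank U, n), row_free Z /\ (Z <= U)%MS.
  by exists (row_base U); rewrite row_base_free eq_row_base.
rewrite rU => -[Z [fZ ZU]].
have ZE a b : a *: row 0 Z + b *: row 1 Z = (\row_j if j == 0 then a else b) *m Z.
  apply/rowP => l; rewrite mulmx2E !mxE /=; ring.
have inj a b : a *: row 0 Z + b *: row 1 Z = 0 -> a = 0 /\ b = 0.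
  rewrite ZE -(mul0mx _ Z) => /(row_free_inj fZ) /rowP E.
  by have := E 0; have := E 1; rewrite !mxE /= => -> ->.
exists (row 0 Z), (row 1 Z); split.
- exact: submx_trans (row_sub _ _) ZU.
- exact: submx_trans (row_sub _ _) ZU.
- apply/eqP => x0; have [] := inj 1 0; last by move/eqP; rewrite oner_eq0.
  by rewrite x0 scaler0 scale0r addr0.
- by move=> a b /inj[].
Qed.

(** Modulo [P], the map [K] goes from the plane [ker V] to the quotient plane of
    the symmetric forms by the line of [P]; it has a nonzero kernel if and only
    if its values are pairwise dependent. *)
Lemma umbilic_direction_triple_det n p (V : 'M[R]_(n, p)) (K : 'rV[R]_n -> 'M[R]_2) P :
  \rank (kermx V) = 2 -> P != 0 -> P^T = P ->
  (forall a v w, K (a *: v + w) = a *: K v + K w) -> (forall v, (K v)^T = K v) ->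
  (exists w, [/\ w != 0, w *m V = 0 & exists c, K w = c *: P]) <->
  (forall v w, v *m V = 0 -> w *m V = 0 -> triple_det P (K v) (K w) = 0).
Proof.
move=> rV Pn0 PT Klin KT.
have K0 : K 0 = 0.
  by have := Klin (- 1) 0 0; rewrite scaler0 addr0 scaleN1r addNr.
have K2 a b v w : K (a *: v + b *: w) = a *: K v + b *: K w.
  by rewrite Klin -[b *: w]addr0 Klin K0 addr0.
split=> [[w [w0 wV [c Kw]]] v v' vV v'V|H].
  have ker (z : 'rV[R]_n) : z *m V = 0 -> (z <= kermx V)%MS.
    by move=> zV; apply/sub_kermxP.
  have [a [b [b' [nz E]]]] := three_in_plane rV (ker _ wV) (ker _ vV) (ker _ v'V).
  apply: (@triple_det_dependent _ _ _ (a * c) b b').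
    rewrite -scalerA -Kw -K2 -[K (_ + _)]scale1r -K2 scale1r E K0.
    by [].
  apply: contraTT nz; rewrite !negb_or !negbK => /andP[/andP[_ /eqP b0] /eqP b'0].
  move: E; rewrite b0 b'0 !scale0r !addr0 => /eqP.
  by rewrite scaler_eq0 (negbTE w0) orbF eqxx !andbT.
have [x [y [xU yU x0 indep]]] := plane_basis rV.
have xV : x *m V = 0 by apply/sub_kermxP.
have yV : y *m V = 0 by apply/sub_kermxP.
have [Kx|[a [b [c [c0 E]]]]] :=
  triple_det_relation Pn0 PT (KT x) (KT y) (H x y xV yV).
  by exists x.
exists (b *: x + c *: y); split.
- by apply: contra c0 => /eqP /indep /eqP.
- by rewrite mulmxDl -!scalemxAl xV yV !scaler0 addr0.
- by exists a; rewrite K2.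
Qed.

End Pencil.

(** * Change of charts *)

Section Charts.
Context {R : realType} {m : nat} {M : manifold R m}.
Implicit Types (i j k : chart M) (p q : M) (U : set M).

Lemma coord_image_open i U : open U -> U `<=` dom i -> open (coord i @` U).
Proof.
move=> oU Ui; rewrite openE => _ [p Up <-].
have iu : (coord i @` dom i) (coord i p) by exists p => //; exact: Ui.
have near_dom : nbhs (coord i p) (coord i @` dom i).
  by apply: open_nbhs_nbhs; split=> //; exact: coord_open.
have near_U : \forall t \near coord i p, U (param i t).
  apply: (param_continuous iu); rewrite coordK; last exact: Ui.
  exact: open_nbhs_nbhs.
apply: filterS2 near_dom near_U => t [q iq <-].
by rewrite coordK// => Uq; exists q.
Qed.

(** Lets the lemmas on local expressions of maps apply to the transition maps and
    to the tangent fields, which are the fields along the identity. *)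
Lemma smooth_idfun : smooth_map (idfun : M -> M).
Proof. by split=> [x|i j]; [exact: cvg_id|exact: transition_smooth]. Qed.

End Charts.

Section LocalMaps.
Context {R : realType} {m n : nat} {S : manifold R m} {V : manifold R n}.
Variable f : S -> V.
Hypothesis sf : smooth_map f.
Implicit Types (i : chart S) (j : chart V) (p q : S).

Lemma local_mapE i j p : dom i p -> local_map f i j (coord i p) = coord j (f p).
Proof. by move=> ip; rewrite /local_map /= coordK. Qed.

Lemma local_dom_open i j : open (dom i `&` f @^-1` dom j).
Proof.
apply: openI; first exact: dom_open.
by apply: open_comp (dom_open j) => x _; exact: sf.1.
Qed.

Lemma local_set_open i j : open (coord i @` (dom i `&` f @^-1` dom j)).
Proof. by apply: coord_image_open; [exact: local_dom_open|exact: subIsetl]. Qed.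

Lemma differentiable_local_map i j p : dom i p -> dom j (f p) ->
  differentiable (local_map f i j) (coord i p).
Proof.
by move=> ip jp; apply: smooth_differentiable (sf.2 i j) _; exists p.
Qed.

End LocalMaps.

Section LocalMapJacobians.
Context {R : realType} {m n : nat} {S : manifold R m} {V : manifold R n}.
Variable f : S -> V.
Hypothesis sf : smooth_map f.
Implicit Types (i : chart S) (j : chart V) (p q : S).

Lemma jacobian_local_mapr i j k p : dom i p -> dom j (f p) -> dom k (f p) ->
  'J (local_map f i j) (coord i p) *m 'J (coord k \o param j) (coord j (f p)) =
  'J (local_map f i k) (coord i p).
Proof.
move=> ip jp kp.
have dF := differentiable_local_map sf ip jp.
have dT := differentiable_local_map (@smooth_idfun R n V) jp kp.
have FE := local_mapE f j ip.
have -> : 'J (coord k \o param j) (coord j (f p)) =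
    'J (local_map (idfun : V -> V) j k) (local_map f i j (coord i p)).
  by rewrite FE.
rewrite -FE in dT; apply: etrans (esym (jacobian_comp dF dT)) _.
apply: near_eq_jacobian; last exact: differentiable_comp.
have E t : (coord i @` (dom i `&` f @^-1` dom j)) t ->
    (local_map (idfun : V -> V) j k \o local_map f i j) t = local_map f i k t.
  by move=> [q [iq jq] <-]; rewrite /= local_mapE// /local_map /= !coordK.
have Ap : (coord i @` (dom i `&` f @^-1` dom j)) (coord i p) by exists p.
exact: open_near (local_set_open (i := i) (j := j) sf) E Ap.
Qed.

Lemma jacobian_local_mapl i i' j p : dom i p -> dom i' p -> dom j (f p) ->
  'J (coord i' \o param i) (coord i p) *m 'J (local_map f i' j) (coord i' p) =
  'J (local_map f i j) (coord i p).
Proof.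
move=> ip i'p jp.
have dT := differentiable_local_map (@smooth_idfun R m S) ip i'p.
have dF := differentiable_local_map sf i'p jp.
have TE := local_mapE (idfun : S -> S) i' ip.
have -> : 'J (local_map f i' j) (coord i' p) =
    'J (local_map f i' j) (local_map (idfun : S -> S) i i' (coord i p)).
  by rewrite TE.
rewrite -[coord i' p]TE in dF; apply: etrans (esym (jacobian_comp dT dF)) _.
apply: near_eq_jacobian; last exact: differentiable_comp.
have E t : (coord i @` (dom i `&` dom i')) t ->
    (local_map f i' j \o local_map (idfun : S -> S) i i') t = local_map f i j t.
  by move=> [q [iq i'q] <-]; rewrite /= local_mapE// /local_map /= !coordK.
have Ap : (coord i @` (dom i `&` dom i')) (coord i p) by exists p.
exact: open_near (local_set_open (i := i) (j := i') (@smooth_idfun R m S)) E Ap.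
Qed.

End LocalMapJacobians.

Section Transitions.
Context {R : realType} {n : nat} {V : manifold R n}.
Implicit Types (i j k : chart V) (p : V).

Definition transition_jacobian i j p : 'M[R]_n :=
  'J (coord j \o param i) (coord i p).

Lemma transition_jacobianM i j k p : dom i p -> dom j p -> dom k p ->
  transition_jacobian i j p *m transition_jacobian j k p =
  transition_jacobian i k p.
Proof. by move=> ip jp kp; exact: (jacobian_local_mapr (@smooth_idfun R n V)). Qed.

Lemma transition_jacobian1 i p : dom i p -> transition_jacobian i i p = 1%:M.
Proof.
move=> ip; rewrite -(jacobian_id (coord i p)); apply: near_eq_jacobian.
  have E t : (coord i @` dom i) t -> (coord i \o param i) t = t.
    by move=> [q iq <-] /=; rewrite coordK.
  have Ap : (coord i @` dom i) (coord i p) by exists p.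
  exact: open_near (@coord_open _ _ V i) E Ap.
exact: (differentiable_local_map (@smooth_idfun R n V) ip ip).
Qed.

Lemma transition_jacobianK i j p : dom i p -> dom j p ->
  transition_jacobian i j p *m transition_jacobian j i p = 1%:M.
Proof. by move=> ip jp; rewrite transition_jacobianM// transition_jacobian1. Qed.

Lemma transition_jacobian_unit i j p : dom i p -> dom j p ->
  transition_jacobian i j p \in unitmx.
Proof. by move=> ip jp; exact: (mulmx1_unit (transition_jacobianK ip jp)).1. Qed.

Lemma minkowski_unit : minkowski R n \in unitmx.
Proof.
have : minkowski R n *m minkowski R n = 1%:M.
  apply/matrixP => i j; rewrite /minkowski mul_diag_mx !mxE.
  case: (eqVneq i j) => [->|_]; last by rewrite !mulr0n mulr0.
  by rewrite !mulr1n; case: ifP => _; rewrite ?mulrNN mulr1.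
by move/mulmx1_unit => -[].
Qed.

Variable g : lorentz_metric V.

Lemma gram_unit p : g p \in unitmx.
Proof.
have [P uP E] := gram_signature g p.
have := minkowski_unit; rewrite -E !unitmx_mul => /andP[/andP[_ gu] _].
exact: gu.
Qed.

Lemma local_metricE i p : dom i p ->
  local_metric g i (coord i p) =
  transition_jacobian i (chart_at p) p *m g p
  *m (transition_jacobian i (chart_at p) p)^T.
Proof. by move=> ip; rewrite /local_metric /= coordK. Qed.

Lemma local_metric_sym i u : (local_metric g i u)^T = local_metric g i u.
Proof. by rewrite /local_metric !trmx_mul trmxK gram_sym mulmxA. Qed.

Lemma local_metric_unit i u : (coord i @` dom i) u -> local_metric g i u \in unitmx.
Proof.
move=> [p ip <-]; rewrite local_metricE// !unitmx_mul unitmx_tr gram_unit.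
by rewrite transition_jacobian_unit//; exact: dom_chart_at.
Qed.

Lemma local_metric_chart_at p :
  local_metric g (chart_at p) (coord (chart_at p) p) = g p.
Proof.
have ip := dom_chart_at p.
by rewrite local_metricE// transition_jacobian1// trmx1 mulmx1 mul1mx.
Qed.

Lemma componentsE j p (w : 'rV[R]_n) :
  components j p w = w *m transition_jacobian (chart_at p) j p.
Proof. by []. Qed.

Lemma components_chart_at p (w : 'rV[R]_n) : components (chart_at p) p w = w.
Proof. by rewrite componentsE transition_jacobian1 ?mulmx1//; exact: dom_chart_at. Qed.

End Transitions.

(** * Fields along an immersion *)

Lemma local_fieldE (R : realType) m n (S : manifold R m) (V : manifold R n)
    (f : S -> V) (i : chart S) (j : chart V) (W : S -> 'rV[R]_n) q :
  dom i q -> local_field f i j W (coord i q) = components j (f q) (W q).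
Proof. by move=> iq; rewrite /local_field coordK. Qed.

Section Extension.
Context {R : realType} {m n : nat} {S : manifold R m} {V : manifold R n}.
Variable f : S -> V.
Hypothesis sf : smooth_map f.
Variables (i : chart S) (j : chart V).
Variable h : 'rV[R]_m -> 'rV[R]_n.
Hypothesis sh : smooth_on (coord i @` (dom i `&` f @^-1` dom j)) h.

(** The field whose components in the charts [i] and [j] are given by [h]; being
    represented at [q] in the chart chosen at [f q], it is obtained from [h] by a
    change of chart that depends on [q]. *)
Definition extension (q : S) : 'rV[R]_n :=
  h (coord i q) *m transition_jacobian j (chart_at (f q)) (f q).

Lemma components_extension k q : dom j (f q) -> dom k (f q) ->
  components k (f q) (extension q) =
  h (coord i q) *m transition_jacobian j k (f q).
Proof.
move=> jq kq; rewrite componentsE /extension -mulmxA transition_jacobianM//.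
exact: dom_chart_at.
Qed.

Lemma extension_at q : i = chart_at q -> j = chart_at (f q) ->
  extension q = h (coord i q).
Proof.
move=> iq jq; rewrite /extension -jq transition_jacobian1 ?mulmx1// jq.
exact: dom_chart_at.
Qed.

(** In a further pair of charts the arbitrary choice of a chart at each point
    drops out by the cocycle relation, leaving compositions and products of smooth
    maps. *)
Lemma smooth_extension : smooth_field f (dom i `&` f @^-1` dom j) extension.
Proof.
move=> i' j'; set U := dom i `&` f @^-1` dom j.
set A := coord i' @` _.
have oA : open A.
  apply: coord_image_open; last by move=> q [[]].
  apply: openI; first by apply: openI; [exact: local_dom_open|exact: dom_open].
  by apply: open_comp (dom_open j') => x _; exact: sf.1.
have A_sub_i : A `<=` coord i' @` (dom i' `&` dom i).
  by move=> _ [q [[[iq jq] i'q] j'q] <-]; exists q.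
have A_sub_f : A `<=` coord i' @` (dom i' `&` f @^-1` dom j).
  by move=> _ [q [[[iq jq] i'q] j'q] <-]; exists q.
have sT : smooth_on A (coord i \o param i').
  exact: smooth_sub A_sub_i (transition_smooth i' i).
have sF : smooth_on A (local_map f i' j).
  exact: smooth_sub A_sub_f (sf.2 i' j).
have sTT : smooth_on (coord j @` (dom j `&` dom j'))
    (fun u => 'J (coord j' \o param j) u).
  apply: smooth_jacobian; last exact: transition_smooth.
  exact: (local_set_open (@smooth_idfun R n V)).
have TA u : A u -> (coord i @` (dom i `&` f @^-1` dom j)) ((coord i \o param i') u).
  by move=> [q [[[iq jq] i'q] j'q] <-]; rewrite /= coordK//; exists q.
have FA u : A u -> (coord j @` (dom j `&` dom j')) (local_map f i' j u).
  move=> [q [[[iq jq] i'q] j'q] <-]; rewrite local_mapE//.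
  by exists (f q).
have sh' := smooth_comp oA (local_set_open (i := i) (j := j) sf) TA sT sh.
have oj := local_set_open (i := j) (j := j') (@smooth_idfun R n V).
have sT' := smooth_comp oA oj FA sF sTT.
apply: (smooth_eq oA _ (smooth_mulmx oA sh' sT')) => _ [q [[[iq jq] i'q] j'q] <-].
have ET : (coord i \o param i') (coord i' q) = coord i q by rewrite /= coordK.
rewrite ET (local_mapE f j i'q); apply: esym.
apply: etrans (local_fieldE f _ _ i'q) _.
exact: components_extension.
Qed.

End Extension.

Section Submanifold.
Context {R : realType} {m n : nat} {S : manifold R m} {V : manifold R n}.
Variables (g : lorentz_metric V) (f : S -> V).
Hypotheses (sf : smooth_map f) (fspace : spacelike g f).
Implicit Types (i : chart S) (j : chart V) (p q : S).

Lemma local_map_image i j u : (coord i @` (dom i `&` f @^-1` dom j)) u ->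
  (coord j @` dom j) (local_map f i j u).
Proof. by move=> [q [iq jq] <-]; rewrite local_mapE//; exists (f q). Qed.

Lemma jacobian_differential i j q : dom i q -> dom j (f q) ->
  'J (local_map f i j) (coord i q) *m
    transition_jacobian j (chart_at (f q)) (f q) =
  transition_jacobian i (chart_at q) q *m differential f q.
Proof.
move=> iq jq; have kq := dom_chart_at (f q); have lq := dom_chart_at q.
apply: etrans (jacobian_local_mapr sf iq jq kq) _.
exact: esym (jacobian_local_mapl sf iq lq kq).
Qed.

Definition first_form q : 'M[R]_m :=
  differential f q *m g (f q) *m (differential f q)^T.

Lemma first_form_sym q : (first_form q)^T = first_form q.
Proof. by rewrite /first_form !trmx_mul trmxK gram_sym mulmxA. Qed.

(** A spacelike immersion induces a positive definite, hence nondegenerate,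
    metric. *)
Lemma first_form_unit q : first_form q \in unitmx.
Proof.
rewrite -row_free_unit; apply: inj_row_free => v vP.
apply: contraPeq vP => v0 vP.
have := fspace q v0; rewrite inner_mulmx -(mulmxA v) -(mulmxA v) -/(first_form q).
by rewrite vP mul0mx mxE ltxx.
Qed.

Lemma local_first_form_unit i j u : (coord i @` (dom i `&` f @^-1` dom j)) u ->
  'J (local_map f i j) u *m local_metric g j (local_map f i j u)
    *m ('J (local_map f i j) u)^T \in unitmx.
Proof.
move=> [q [iq jq] <-]; rewrite local_mapE// local_metricE//.
have lq := dom_chart_at q.
have uC := transition_jacobian_unit iq lq.
have := jacobian_differential iq jq.
move: ('J _ _) (transition_jacobian j _ _) (transition_jacobian i _ _) uC.
move=> J T C uC E.
have -> : J *m (T *m g (f q) *m T^T) *m J^T = C *m first_form q *m C^T.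
  transitivity ((J *m T) *m g (f q) *m (J *m T)^T).
    by rewrite trmx_mul !mulmxA.
  by rewrite E /first_form trmx_mul !mulmxA.
by rewrite !unitmx_mul unitmx_tr uC first_form_unit.
Qed.

Lemma normal_vectorP q (w : 'rV[R]_n) :
  normal_vector g f q w <-> w *m g (f q) *m (differential f q)^T = 0.
Proof.
split=> [nw|nw v]; last by rewrite inner_mulmx nw mul0mx mxE.
apply/rowP => l; have := nw (delta_mx 0 l).
by rewrite inner_mulmx trmx_delta -colE !mxE.
Qed.

(** Orthogonality to the image of [f] can be tested in any pair of charts. *)
Lemma local_normal i j q (w : 'rV[R]_n) : dom i q -> dom j (f q) ->
  components j (f q) w *m local_metric g j (coord j (f q))
    *m ('J (local_map f i j) (coord i q))^T =
  w *m g (f q) *m (differential f q)^T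
    *m (transition_jacobian i (chart_at q) q)^T.
Proof.
move=> iq jq; rewrite componentsE local_metricE//.
have := transition_jacobianK (dom_chart_at (f q)) jq.
have := jacobian_differential iq jq.
move: ('J _ _) (transition_jacobian j _ _) (transition_jacobian i _ _).
move: (transition_jacobian _ j _) => T' J T C E K.
transitivity (w *m (T' *m T) *m g (f q) *m (J *m T)^T).
  by rewrite trmx_mul !mulmxA.
by rewrite K mulmx1 E trmx_mul mulmxA.
Qed.

Lemma local_normal_on i j U (N : S -> 'rV[R]_n) : normal_field g f U N ->
  normal_on (coord i @` (U `&` dom i `&` f @^-1` dom j)) (local_metric g j)
    (local_map f i j) (local_field f i j N).
Proof.
move=> [_ nN] _ [q [[Uq iq] jq] <-]; rewrite local_mapE// /local_field coordK//.
by rewrite local_normal// (normal_vectorP q (N q)).1 ?mul0mx//; exact: nN.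
Qed.

End Submanifold.

Lemma smooth_field_sub (R : realType) m n (S : manifold R m) (V : manifold R n)
    (f : S -> V) (U U' : set S) (W : S -> 'rV[R]_n) :
  U `<=` U' -> smooth_field f U' W -> smooth_field f U W.
Proof.
move=> UU' sW i j; apply: smooth_sub (sW i j) => _ [q [[Uq iq] jq] <-].
by exists q => //; split=> //; split=> //; exact: UU'.
Qed.

(** * The two conditions at a point *)

Section AtPoint.
Context {R : realType} {m n : nat} {S : manifold R m} {V : manifold R n}.
Variables (g : lorentz_metric V) (f : S -> V).
Hypotheses (sf : smooth_map f) (fspace : spacelike g f).
Variable x : S.

Let i := chart_at x.
Let j := chart_at (f x).
Let G := local_metric g j.
Let F := local_map f i j.
Let D := dom i `&` f @^-1` dom j.

Definition shape_at (w : 'rV[R]_n) : 'M[R]_m := shape_mx G F (coord i x) w.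

Let ix : dom i x. Proof. exact: dom_chart_at. Qed.
Let jx : dom j (f x). Proof. exact: dom_chart_at. Qed.

Let Fx : F (coord i x) = coord j (f x). Proof. exact: local_mapE. Qed.

Let GFx : G (F (coord i x)) = g (f x).
Proof. by rewrite Fx /G local_metric_chart_at. Qed.

Let oB : open (coord j @` dom j). Proof. exact: coord_open. Qed.

Let sG : smooth_on (coord j @` dom j) G. Proof. exact: gram_smooth. Qed.

Let symG p : (coord j @` dom j) p -> (G p)^T = G p.
Proof. by move=> _; exact: local_metric_sym. Qed.

Let uG p : (coord j @` dom j) p -> G p \in unitmx.
Proof. exact: local_metric_unit. Qed.

Section Neighborhood.
Variable U : set S.
Hypotheses (oU : open U) (Ux : U x).

Let A := coord i @` (U `&` dom i `&` f @^-1` dom j).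

Lemma coord_nbhd_sub : A `<=` coord i @` D.
Proof. by move=> _ [q [[Uq iq] jq] <-]; exists q. Qed.

Lemma coord_nbhd_open : open A.
Proof.
apply: coord_image_open; last by move=> q [[]].
apply: openI; first by apply: openI; [exact: oU|exact: dom_open].
by apply: open_comp (dom_open j) => q _; exact: sf.1.
Qed.

Lemma coord_nbhd_mem : A (coord i x). Proof. by exists x. Qed.

Lemma coord_nbhd_image u : A u -> (coord j @` dom j) (F u).
Proof. by move=> /coord_nbhd_sub; exact: local_map_image. Qed.

Lemma coord_nbhd_smooth : smooth_on A F.
Proof. exact: smooth_sub coord_nbhd_sub (sf.2 i j). Qed.

Lemma coord_nbhd_form_unit u : A u -> 'J F u *m G (F u) *m ('J F u)^T \in unitmx.
Proof. by move=> /coord_nbhd_sub; exact: (local_first_form_unit sf fspace). Qed.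

Lemma coord_nbhd_field X : tangent_field U X ->
  smooth_on A (local_field (idfun : S -> S) i i X).
Proof.
move=> /(_ i i); apply: smooth_sub => _ [q [[Uq iq] jq] <-].
by exists q.
Qed.

Lemma first_formE : 'J F (coord i x) *m G (F (coord i x)) *m ('J F (coord i x))^T =
  first_form g f x.
Proof. by rewrite GFx. Qed.

(** [ricci_defect] in the charts chosen at [x] and [f x], where the components of
    a vector are the vector itself. *)
Lemma curvature_identityP X Y N :
  tangent_field U X -> tangent_field U Y -> normal_field g f U N ->
  normal_curvature g f X Y N x =
  normal_part g f x (riemann g (f x) (X x *m differential f x)
    (Y x *m differential f x) (N x)) <->
  forall M, normal_vector g f x M ->
    X x *m (shape_at M *m invmx (first_form g f x) *m shape_at (N x)) *m (Y x)^T =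
    Y x *m (shape_at M *m invmx (first_form g f x) *m shape_at (N x)) *m (X x)^T.
Proof.
move=> tX tY nN.
have fieldE W : local_field f i j W (coord i x) = W x.
  by rewrite local_fieldE// components_chart_at.
have tfieldE W : local_field (idfun : S -> S) i i W (coord i x) = W x.
  by rewrite local_fieldE// components_chart_at.
have nN' : normal_on A G F (local_field f i j N) by exact: local_normal_on.
have := ricci_defect coord_nbhd_open oB coord_nbhd_image coord_nbhd_smooth
  sG symG uG coord_nbhd_form_unit
  (coord_nbhd_field tX) (coord_nbhd_field tY) (nN.1 i j) nN' coord_nbhd_mem.
rewrite /= fieldE !tfieldE first_formE GFx => RD.
have riemE : riemann g (f x) (X x *m differential f x) (Y x *m differential f x) (N x) =
    N x *m curvature_mx G (F (coord i x)) (X x *m differential f x)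
      (Y x *m differential f x).
  rewrite Fx; apply: (local_riemannE _ _ _ oB sG uG).
  by exists (f x).
rewrite /normal_part riemE; apply: iff_trans RD _.
by split=> H M; [move/normal_vectorP|move=> nM]; apply: H => //; apply/normal_vectorP.
Qed.

End Neighborhood.

Lemma shape_at_linear a v w :
  shape_at (a *: v + w) = a *: shape_at v + shape_at w.
Proof. exact: shape_mx_linear. Qed.

Lemma shape_at_sym w : (shape_at w)^T = shape_at w.
Proof.
have Tx : setT x by [].
have oA := coord_nbhd_open (@openT S); have Ax := coord_nbhd_mem Tx.
exact: (shape_mx_sym oA oB (@coord_nbhd_image setT) (@coord_nbhd_smooth setT) sG symG w Ax).
Qed.

(** The constant field [w] of the charts, projected onto the normal spaces. *)
Lemma normal_extension w : normal_vector g f x w ->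
  exists N, normal_field g f D N /\ N x = w.
Proof.
move=> /normal_vectorP nw.
pose h u := normal (G (F u)) ('J F u) w.
have oA : open (coord i @` D) by exact: local_set_open.
have sF : smooth_on (coord i @` D) F by exact: sf.2.
have FB u : (coord i @` D) u -> (coord j @` dom j) (F u) by exact: local_map_image.
have sGF : smooth_on (coord i @` D) (fun u => G (F u)) by exact: smooth_comp sG.
have sJ := smooth_jacobian oA sF; have sJT := smooth_trmx oA sJ.
have uP u : (coord i @` D) u -> 'J F u *m G (F u) *m ('J F u)^T \in unitmx.
  exact: (local_first_form_unit sf fspace).
have sh : smooth_on (coord i @` D) h.
  apply: smoothD => //; first exact: smooth_cst.
  apply: smoothN => //; apply: smooth_mulmx => //.
  apply: smooth_mulmx => //; last first.
    by apply: smooth_invmx => //; do 2!apply: smooth_mulmx => //.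
  apply: smooth_mulmx => //; apply: smooth_mulmx => //; exact: smooth_cst.
exists (extension f i j h); split; last first.
  by rewrite extension_at// /h GFx normal_id.
split; first exact: smooth_extension.
move=> q [iq jq]; apply/normal_vectorP.
have Dq : (coord i @` D) (coord i q) by exists q.
have lq := dom_chart_at q.
have uC : (transition_jacobian i (chart_at q) q)^T \in unitmx.
  by rewrite unitmx_tr transition_jacobian_unit.
apply: (can_inj (mulmxK uC)); rewrite mul0mx -(local_normal g sf _ iq jq).
have compE : components j (f q) (extension f i j h q) = h (coord i q).
  by rewrite (components_extension _ _ jq jq) transition_jacobian1 ?mulmx1.
rewrite compE -(local_mapE f j iq); exact: normal_orthogonal (uP _ Dq) _.
Qed.

Lemma tangent_extension v : exists X, tangent_field D X /\ X x = v.
Proof.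
exists (extension (idfun : S -> S) i i (cst v)); split.
  apply: (@smooth_field_sub _ _ _ _ _ _ D (dom i `&` dom i)); first by move=> q [].
  by apply: (@smooth_extension _ _ _ _ _ idfun (@smooth_idfun R m S)); exact: smooth_cst.
by rewrite extension_at.
Qed.

End AtPoint.

Lemma umbilical_alongP (R : realType) n (S : manifold R 2) (V : manifold R n)
    (g : lorentz_metric V) (f : S -> V) (x : S) (w : 'rV[R]_n) :
  smooth_map f -> spacelike g f -> normal_vector g f x w ->
  umbilical_along g f x w <-> exists c, shape_at g f x w = c *: first_form g f x.
Proof.
move=> sf fspace nw.
have weingartenP U N : open U -> U x -> normal_field g f U N -> N x = w ->
    (forall v, weingarten g f N x v =
       (2%:R^-1 * inner (g (f x)) (mean_curvature g f x) w) *: v) <->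
    exists c, shape_at g f x w = c *: first_form g f x.
  move=> oU Ux nN Nx.
  pose i := chart_at x; pose j := chart_at (f x).
  pose A := coord i @` (U `&` dom i `&` f @^-1` dom j).
  have nN' : normal_on A (local_metric g j) (local_map f i j) (local_field f i j N).
    exact: local_normal_on.
  have AB u : A u -> (coord j @` dom j) (local_map f i j u) by exact: coord_nbhd_image.
  have sF : smooth_on A (local_map f i j) by exact: coord_nbhd_smooth.
  have uP u : A u -> 'J (local_map f i j) u *m local_metric g j (local_map f i j u)
      *m ('J (local_map f i j) u)^T \in unitmx by exact: coord_nbhd_form_unit.
  have := local_umbilicalP (coord_nbhd_open sf oU) (@coord_open _ _ V j) AB sF
    (@gram_smooth _ _ _ g j) (fun p _ => local_metric_sym g j p)
    (@local_metric_unit _ _ _ g j) uP (nN.1 i j) nN' (coord_nbhd_mem f Ux).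
  rewrite first_formE local_mapE; last exact: dom_chart_at.
  rewrite local_metric_chart_at local_fieldE; last exact: dom_chart_at.
  by rewrite components_chart_at Nx.
split=> [[U [N [oU Ux nN Nx /(weingartenP U N oU Ux nN Nx)]]]//|K].
have [N [nN Nx]] := normal_extension sf fspace nw.
exists (dom (chart_at x) `&` f @^-1` dom (chart_at (f x))), N.
have oD := local_dom_open sf (chart_at x) (chart_at (f x)).
have Dx : (dom (chart_at x) `&` f @^-1` dom (chart_at (f x))) x.
  by split; exact: dom_chart_at.
by split=> //; exact: (weingartenP _ N oD Dx nN Nx).2 K.
Qed.

Theorem theorem2 (R : realType) (V : manifold R 4) (g : lorentz_metric V)
    (V_oriented : oriented V)
    (T : V -> 'rV[R]_4) (V_time_oriented : time_orientation g T)
    (S : manifold R 2) (f : S -> V)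
    (f_immersion : immersion f) (S_spacelike : spacelike g f) :
  umbilical_along_normal_direction g f <->
  (forall (U : set S) (X Y : S -> 'rV[R]_2) (N : S -> 'rV[R]_4),
     open U -> tangent_field U X -> tangent_field U Y -> normal_field g f U N ->
     forall x : S, U x ->
       normal_curvature g f X Y N x =
       normal_part g f x
         (riemann g (f x) (X x *m differential f x) (Y x *m differential f x)
            (N x))).
Proof.
have sf : smooth_map f := f_immersion.1.
have symP x : (first_form g f x)^T = first_form g f x by exact: first_form_sym.
have unitP x : first_form g f x \in unitmx by exact: first_form_unit.
have shapeT x w : (shape_at g f x w)^T = shape_at g f x w.
  exact: shape_at_sym.
have commuteP x v w : (forall a b : 'rV[R]_2,
    a *m (shape_at g f x v *m invmx (first_form g f x) *m shape_at g f x w) *m b^T =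
    b *m (shape_at g f x v *m invmx (first_form g f x) *m shape_at g f x w) *m a^T)
    <-> triple_det (first_form g f x) (shape_at g f x v) (shape_at g f x w) = 0.
  by apply: triple_detP.
(* Umbilical directions at a point, by linear algebra in the normal plane. *)
have pencil x : (exists w, [/\ w != 0, normal_vector g f x w &
      umbilical_along g f x w]) <->
    forall v w, normal_vector g f x v -> normal_vector g f x w ->
      triple_det (first_form g f x) (shape_at g f x v) (shape_at g f x w) = 0.
  pose W := g (f x) *m (differential f x)^T.
  have nP w : normal_vector g f x w <-> w *m W = 0.
    by rewrite /W mulmxA; exact: normal_vectorP.
  have rW : \rank (kermx W) = 2.
    have rW2 : \rank W = 2.
      apply/eqP; rewrite eqn_leq rank_leq_col /=.
      have := mxrankM_maxr (differential f x) W.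
      by rewrite /W mulmxA -/(first_form g f x) (mxrank_unit (unitP x)).
    by rewrite mxrank_ker rW2.
  have P0 : first_form g f x != 0.
    by apply/eqP => P0; have := mxrank_unit (unitP x); rewrite P0 mxrank0.
  have := umbilic_direction_triple_det rW P0 (symP x)
    (fun a v w => shape_at_linear g f x a v w) (shapeT x).
  move=> UP; split=> [[w [w0 nw uw]] v v' nv nv'|H].
    apply: UP.1 => //; [|exact/nP|exact/nP].
    by exists w; split=> //; [exact/nP|exact/(umbilical_alongP sf S_spacelike nw)].
  have [|w [w0 /nP nw Kw]] := UP.2.
    by move=> v w /nP nv /nP nw; exact: H.
  by exists w; split=> //; exact/(umbilical_alongP sf S_spacelike nw).
split=> [umb U X Y N oU tX tY nN x Ux|curv x].
  apply/(curvature_identityP sf S_spacelike oU Ux tX tY nN) => M nM.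
  have /pencil H := umb x.
  exact: (commuteP x M (N x)).2 (H M (N x) nM (nN.2 x Ux)) (X x) (Y x).
apply/pencil => v w nv nw; apply/commuteP => a b.
pose D := dom (chart_at x) `&` f @^-1` dom (chart_at (f x)).
have oD : open D by exact: local_dom_open.
have Dx : D x by split; exact: dom_chart_at.
have [N [nN Nx]] := normal_extension sf S_spacelike nw.
have [X [tX Xx]] := tangent_extension f x a.
have [Y [tY Yx]] := tangent_extension f x b.
have := curv D X Y N oD tX tY nN x Dx.
move/(curvature_identityP sf S_spacelike oD Dx tX tY nN)/(_ v nv).
by rewrite Xx Yx Nx.
Qed.
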